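(* Let $f=\frac1n\sum_{i=1}^n f_i$ on $\mathbb{R}^p$, where each $f_i$ is $\mu$-strongly convex and $L$-smooth ($\mu,L>0$), let the stochastic gradients be unbiased with variance at most $\sigma^2$, and let $W\in\mathbb{R}^{n\times n}$ be doubly stochastic with $\rho_W:=\|W-\mathbf{J}\|_2^2<1$. Let $d_1,d_2\geq 1$ be integers and let $(X_t,Y_t)_{t\ge 0}$ be the iterates of the FlexGT algorithm with communication frequency $d_1$, computation frequency $d_2$ and stepsize $\gamma>0$, as described in the context. Suppose $$\gamma \leq \min\left\{\frac{1}{10d_2L},\ \frac{1-\rho_W^{d_1}}{37d_2L\sqrt[4]{\rho_W^{d_1}}},\ \frac{(1-\rho_W^{d_1})^2}{153d_2L\sqrt{\rho_W^{d_1}}}\right\}.$$ Define $$V_t:=\|\bar x_t-x^*\|^2+c_1\|X_t-\mathbf{1}\bar x_t\|^2+c_2\|Y_t-\mathbf{1}\bar y_t\|^2,$$ $$c_1=\frac{192d_2\gamma L}{n(1-\rho_W^{d_1})},\qquad c_2=\frac{9312d_2^3\gamma^3L}{n(1-\rho_W^{d_1})^3}.$$ Then for all $k\geq 0$, $$\mathbb{E}[V_{d_2(k+1)}]\leq\left(1-\min\left\{\frac{\mu d_2\gamma}{4},\frac{1-\rho_W^{d_1}}{8}\right\}\right)\mathbb{E}[V_{d_2k}]+\frac{d_2\gamma^2\sigma^2}{n}+\frac{d_2^3\gamma^3L}{(1-\rho_W^{d_1})^3}M_\sigma,$$ where $$M_\sigma:=36(1-\rho_W^{d_1})^3\sigm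a^2+3456(1-\rho_W^{d_1})\rho_W^{d_1}\sigma^2+55872\rho_W^{d_1}\sigma^2.$$
   Context: Problem: minimize $f(x)=\frac1n\sum_{i=1}^n f_i(x)$ over $x\in\mathbb{R}^p$, with $f_i(x)=\mathbb{E}_{\xi_i\sim\mathcal{D}_i}[f_i(x;\xi_i)]$; $x^*$ denotes the minimizer of $f$. Points of $\mathbb{R}^p$ are identified with row vectors where needed. Assumptions. Each $f_i$ is $\mu$-strongly convex and $L$-smooth (i.e. $\nabla f_i$ is $L$-Lipschitz). Stochastic gradients satisfy $\mathbb{E}[\nabla f_i(x;\xi_i)]=\nabla f_i(x)$ and $\mathbb{E}[\|\nabla f_i(x;\xi_i)-\nabla f_i(x)\|^2]\leq\sigma^2$ for all $x\in\mathbb{R}^p$, for some $\sigma\ge 0$. The samples $\xi_{i,t}\sim\mathcal{D}_i$ are independent over nodes $i$ and times $t$. The matrix $W$ (supported on a communication graph on $\{1,\dots,n\}$) satisfies $W\mathbf{1}=\mathbf{1}$, $\mathbf{1}^TW=\mathbf{1}^T$, has nonnegative entries, and $\rho_W:=\|W-\mathbf{J}\|_2^2<1$, where $\mathbf{1}\in\mathbb{R}^n$ is the all-ones vector, $\mathbf{J}=\mathbf{1}\mathbf{1}^T/n$ and $\|\cdot\|_2$ is the spectral norm. $\|\cdot\|$ denotes the Frobenius norm (Euclidean norm for vectors). Notation. $X_t=[x_{1,t},\dots,x_{n,t}]^T$, $Y_t=[y_{1,t},\dots,y_{n,t}]^T$, and $\nabla G_t$ is the $n\times p$ matrix with $i$-th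 row $\nabla f_i(x_{i,t};\xi_{i,t})^T$. Averages: $\bar x_t=\frac{\mathbf{1}^T}{n}X_t$, $\bar y_t=\frac{\mathbf{1}^T}{n}Y_t$. FlexGT algorithm. Given initial points $x_{i,0}\in\mathbb{R}^p$, set $Y_0=\nabla G_0$. In round $k=0,1,\dots$, the local steps are $$X_{d_2k+l}=X_{d_2k}-\gamma\sum_{j=0}^{l-1}Y_{d_2k+j},\qquad Y_{d_2k+l}=Y_{d_2k}+\nabla G_{d_2k+l}-\nabla G_{d_2k}\qquad (1\le l\le d_2-1),$$ and the round ends with one further local step followed by $d_1$ communication steps: $$X_{d_2(k+1)}=W^{d_1}\Big(X_{d_2k}-\gamma\sum_{j=0}^{d_2-1}Y_{d_2k+j}\Big),\qquad Y_{d_2(k+1)}=W^{d_1}\big(Y_{d_2k}+\nabla G_{d_2(k+1)}-\nabla G_{d_2k}\big).$$ Here $\nabla G_{d_2(k+1)}$ is evaluated at $X_{d_2(k+1)}$. Terms in the stepsize bound with zero denominator (when $\rho_W=0$) are read as $+\infty$. *)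

(* Defs.v *)
From HB Require Import structures.
From mathcomp Require Import all_boot all_order all_algebra.
From mathcomp Require Import all_classical all_reals all_analysis.

Set Implicit Arguments.
Unset Strict Implicit.
Unset Printing Implicit Defensive.

Import Order.TTheory GRing.Theory Num.Theory.
Import numFieldNormedType.Exports.

Local Open Scope classical_set_scope.
Local Open Scope ring_scope.

(* Points of R^p are row vectors ['rV[R]_p]. The canonical norm of
   MathComp-Analysis on matrices is the sup norm, so the Euclidean/Frobenius
   norm is introduced separately; both induce the same topology, hence the
   same notion of differentiability. *)

Section LinearAlgebra.
Variable R : realType.

Definition fnorm m n (A : 'M[R]_(m, n)) : R :=
  Num.sqrt (\sum_i \sum_j A i j ^+ 2).

Definition spectral_norm m n (A : 'M[R]_(m, n)) : R :=
  sup [set fnorm (A *m v) | v in [set v : 'cV[R]_n | fnorm v <= 1]].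

Definition ones n : 'cV[R]_n := const_mx 1.

Definition Jmx n : 'M[R]_n := n%:R^-1 *: (ones n *m (ones n)^T).

Definition rho n (W : 'M[R]_n) : R := spectral_norm (W - Jmx n) ^+ 2.

Definition doubly_stochastic n (W : 'M[R]_n) : Prop :=
  [/\ W *m ones n = ones n, (ones n)^T *m W = (ones n)^T &
      forall i j, 0 <= W i j].

Definition avg n p (X : 'M[R]_(n, p)) : 'rV[R]_p :=
  n%:R^-1 *: ((ones n)^T *m X).

End LinearAlgebra.

Section Functions.
Variables (R : realType) (p : nat).
Implicit Types f : 'rV[R]_p -> R.

(* Only meaningful where [f] is differentiable. *)
Definition grad f (x : 'rV[R]_p) : 'rV[R]_p :=
  \row_j 'D_(delta_mx 0 j) (f : 'rV[R]_p -> R^o) x.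

Definition differentiable_everywhere f : Prop :=
  forall x, differentiable (f : 'rV[R]_p -> R^o) x.

Definition strongly_convex (mu : R) f : Prop :=
  forall x y (t : R), 0 <= t <= 1 ->
    f (t *: x + (1 - t) *: y) <=
      t * f x + (1 - t) * f y
      - mu / 2 * t * (1 - t) * fnorm (x - y) ^+ 2.

Definition smooth (L : R) f : Prop :=
  differentiable_everywhere f /\
  forall x y, fnorm (grad f x - grad f y) <= L * fnorm (x - y).

End Functions.

Section Independence.
Variables (R : realType) (dO : measure_display) (Omega : measurableType dO).
Variable P : probability Omega R.

(* Mutual independence of a family of random variables with values in possibly
   different measurable spaces. *)
Definition mutually_independent (I : eqType) (d : I -> measure_display)
    (T : forall i, measurableType (d i)) (Z : forall i, {RV P >-> T i}) : Prop :=
  forall (s : seq I) (A : forall i, set (T i)), uniq s ->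
    (forall i, measurable (A i)) ->
    P (\big[setI/setT]_(i <- s) (Z i @^-1` A i)) =
      (\prod_(i <- s) P (Z i @^-1` A i))%E.

End Independence.

Section StochasticObjective.
Variables (R : realType) (n p : nat).
Variables (d : 'I_n -> measure_display) (Xi : forall i, measurableType (d i)).

(* [F i x s] is the sample cost f_i(x; s) and [D i] the distribution of the
   samples of node [i]. *)
Variables (F : forall i, 'rV[R]_p -> Xi i -> R).
Variables (D : forall i, probability (Xi i) R).

Definition local_cost (i : 'I_n) (x : 'rV[R]_p) : R :=
  fine ('E_(D i)[@F i x])%E.

Definition cost (x : 'rV[R]_p) : R := n%:R^-1 * \sum_i local_cost i x.

Definition sample_grad (i : 'I_n) (x : 'rV[R]_p) (s : Xi i) : 'rV[R]_p :=
  grad (fun z => F z s) x.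

Definition unbiased : Prop := forall i x j,
  ('E_(D i)[fun s => (sample_grad x s 0 j)%R])%E = (grad (local_cost i) x 0 j)%R%:E.

Definition variance_le (sigma : R) : Prop := forall i x,
  ('E_(D i)[fun s => (fnorm (sample_grad x s - grad (local_cost i) x) ^+ 2)%R]
     <= (sigma ^+ 2)%:E)%E.

Definition stacked_grad (s : forall i, Xi i) (X : 'M[R]_(n, p)) : 'M[R]_(n, p) :=
  \matrix_(i, j) sample_grad (row i X) (s i) 0 j.

End StochasticObjective.

(* One trajectory of the algorithm: [G t M] is the stacked stochastic gradient
   evaluated at [M] with the samples drawn at time [t]. *)
Record flexGT (R : realType) (n p : nat) (W : 'M[R]_n) (d1 d2 : nat) (gamma : R)
    (G : nat -> 'M[R]_(n, p) -> 'M[R]_(n, p)) (x0 : 'M[R]_(n, p))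
    (X Y : nat -> 'M[R]_(n, p)) : Prop := FlexGT {
  flexGT_X0 : X 0%N = x0;
  flexGT_Y0 : Y 0%N = G 0%N (X 0%N);
  flexGT_Xlocal : forall k l, (1 <= l <= d2 - 1)%N ->
    X (d2 * k + l)%N =
      X (d2 * k)%N - gamma *: \sum_(0 <= j < l) Y (d2 * k + j)%N;
  flexGT_Ylocal : forall k l, (1 <= l <= d2 - 1)%N ->
    Y (d2 * k + l)%N =
      Y (d2 * k)%N + G (d2 * k + l)%N (X (d2 * k + l)%N)
      - G (d2 * k)%N (X (d2 * k)%N);
  flexGT_Xcomm : forall k,
    X (d2 * k.+1)%N =
      (W ^+ d1) *m (X (d2 * k)%N - gamma *: \sum_(0 <= j < d2) Y (d2 * k + j)%N);
  flexGT_Ycomm : forall k,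
    Y (d2 * k.+1)%N =
      (W ^+ d1) *m (Y (d2 * k)%N + G (d2 * k.+1)%N (X (d2 * k.+1)%N)
                    - G (d2 * k)%N (X (d2 * k)%N)) }.

Section Constants.
Variables (R : realType) (n d1 d2 : nat) (rhoW gamma L sigma : R).

(* In [\bar R], 0^-1 = +oo, so the terms whose denominator vanishes are +oo. *)
Definition stepsize_bound : \bar R :=
  Order.min (1%:E / (10 * d2%:R * L)%:E)%E
    (Order.min
      ((1 - rhoW ^+ d1)%:E / (37 * d2%:R * L * (rhoW ^+ d1) `^ (1 / 4))%:E)%E
      (((1 - rhoW ^+ d1) ^+ 2)%:E
         / (153 * d2%:R * L * Num.sqrt (rhoW ^+ d1))%:E)%E).

Definition c1 : R := 192 * d2%:R * gamma * L / (n%:R * (1 - rhoW ^+ d1)).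

Definition c2 : R :=
  9312%N%:R * d2%:R ^+ 3 * gamma ^+ 3 * L / (n%:R * (1 - rhoW ^+ d1) ^+ 3).

Definition Msigma : R :=
  36 * (1 - rhoW ^+ d1) ^+ 3 * sigma ^+ 2
  + 3456 * (1 - rhoW ^+ d1) * rhoW ^+ d1 * sigma ^+ 2
  + 55872%N%:R * rhoW ^+ d1 * sigma ^+ 2.

End Constants.

Definition lyapunov (R : realType) (n p : nat) (a b : R) (xstar : 'rV[R]_p)
    (X Y : 'M[R]_(n, p)) : R :=
  fnorm (avg X - xstar) ^+ 2
  + a * fnorm (X - ones R n *m avg X) ^+ 2
  + b * fnorm (Y - ones R n *m avg Y) ^+ 2.

(* Main.v *)
(* In the Hilbert space of square-integrable random n x p matrices, one round of
   FlexGT is a short computation. Let J average the rows and P = 1 - J. Removing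
   its own noise N_0 from the tracking variable, put Q = Y_0 - N_0; the j-th local
   direction is then Y_j = Q + (grad F(X_j) - grad F(X_0)) + N_j, where the noises
   N_j are orthogonal to each other and to everything known before time j.
   Lipschitz continuity and gamma d2 L <= 1/10 bound the drift E|X_j - X_0|^2 by
   5/2 (gamma d2)^2 (E|Q|^2 + n sigma^2). The mean error loses twice the optimality
   gap at the start of the round; its only cross term with the noise comes from
   grad F(X_j) - grad F(X_0), hence is of higher order. The errors P X and P Y
   contract by rho^d1 up to Young's inequality, and the noise N_0 contained in Y_0
   only costs P Q a constant multiple of n sigma^2 because the rows of N_0 are
   uncorrelated. The weights c1 and c2 make the resulting linear system close. *)

Require Import Defs.
From HB Require Import structures.
From mathcomp Require Import all_boot all_order all_algebra.
From mathcomp Require Import all_classical all_reals all_analysis.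
From mathcomp Require Import measurable_realfun ring lra zify.

Set Implicit Arguments.
Unset Strict Implicit.
Unset Printing Implicit Defensive.

Import Order.TTheory GRing.Theory Num.Theory.
Import numFieldNormedType.Exports.

Local Open Scope classical_set_scope.
Local Open Scope ring_scope.

(** * Frobenius inner product and mixing matrices *)

(** The delicate object is [Q]. After a communication, [Y_0 = W^d1 (U + N_0)] with [U] known before
    the samples of that time, so [Q = W^d1 U + (W^d1 - 1) N_0] still contains [N_0] and need not be
    orthogonal to it. Only its average is clean: the tracking invariant gives [J Q = J grad F(X_0)].
    Orthogonality to the noise is therefore used in full for the mean, which yields the term in
    sigma^2 / n, whereas the consensus estimate separates [P Q] from the noise by Young's
    inequality. Orthogonality is obtained by Fubini's theorem instead of conditional expectations:
    one sample [xi i t] is integrated out while all the others are frozen. A single sample is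
    singled out, not a whole instant, because the rows of [N_0] have to be uncorrelated with each
    other too. Square integrability of the iterates is a conclusion, not an assumption: the variance
    bound is uniform in the point, so the noise is square-integrable whatever the iterate is, and
    Lipschitz gradients propagate the property. *)

Section InnerProduct.
Variable R : realType.

Definition ip m n (A B : 'M[R]_(m, n)) : R := \sum_i \sum_j A i j * B i j.

Lemma ipC m n (A B : 'M[R]_(m, n)) : ip A B = ip B A.
Proof. by apply: eq_bigr => i _; apply: eq_bigr => j _; rewrite mulrC. Qed.

Lemma ipDl m n (A B C : 'M[R]_(m, n)) : ip (A + B) C = ip A C + ip B C.
Proof.
rewrite -big_split; apply: eq_bigr => i _; rewrite -big_split.
by apply: eq_bigr => j _; rewrite mxE mulrDl.
Qed.

Lemma ipZl m n a (A B : 'M[R]_(m, n)) : ip (a *: A) B = a * ip A B.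
Proof.
rewrite mulr_sumr; apply: eq_bigr => i _; rewrite mulr_sumr.
by apply: eq_bigr => j _; rewrite mxE mulrA.
Qed.

Lemma ipNl m n (A B : 'M[R]_(m, n)) : ip (- A) B = - ip A B.
Proof. by rewrite -scaleN1r ipZl mulN1r. Qed.

Lemma ipBl m n (A B C : 'M[R]_(m, n)) : ip (A - B) C = ip A C - ip B C.
Proof. by rewrite ipDl ipNl. Qed.

Lemma ipDr m n (A B C : 'M[R]_(m, n)) : ip C (A + B) = ip C A + ip C B.
Proof. by rewrite ipC ipDl !(ipC C). Qed.

Lemma ipZr m n a (A B : 'M[R]_(m, n)) : ip A (a *: B) = a * ip A B.
Proof. by rewrite ipC ipZl ipC. Qed.

Lemma ipNr m n (A B : 'M[R]_(m, n)) : ip A (- B) = - ip A B.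
Proof. by rewrite ipC ipNl ipC. Qed.

Lemma ipBr m n (A B C : 'M[R]_(m, n)) : ip C (A - B) = ip C A - ip C B.
Proof. by rewrite ipDr ipNr. Qed.

Definition ip_bilin := (ipDl, ipDr, ipNl, ipNr, ipZl, ipZr).

Lemma ip0l m n (A : 'M[R]_(m, n)) : ip 0 A = 0.
Proof. by rewrite -(scale0r 0) ipZl mul0r. Qed.

Lemma ip_suml m n I (r : seq I) (A : I -> 'M[R]_(m, n)) (B : 'M[R]_(m, n)) :
  ip (\sum_(i <- r) A i) B = \sum_(i <- r) ip (A i) B.
Proof.
by elim/big_rec2: _ => [|i y1 y2 _ <-]; rewrite ?ip0l ?ipDl.
Qed.

Lemma ip_ge0 m n (A : 'M[R]_(m, n)) : 0 <= ip A A.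
Proof.
by apply: sumr_ge0 => i _; apply: sumr_ge0 => j _; rewrite -expr2 sqr_ge0.
Qed.

Lemma fnorm_sq m n (A : 'M[R]_(m, n)) : fnorm A ^+ 2 = ip A A.
Proof.
rewrite sqr_sqrtr; last first.
  by apply: sumr_ge0 => i _; apply: sumr_ge0 => j _; rewrite sqr_ge0.
by apply: eq_bigr => i _; apply: eq_bigr => j _; rewrite expr2.
Qed.

Lemma fnorm_ge0 m n (A : 'M[R]_(m, n)) : 0 <= fnorm A.
Proof. exact: sqrtr_ge0. Qed.

Lemma ip_eq0 m n (A : 'M[R]_(m, n)) : ip A A = 0 -> A = 0.
Proof.
move=> /eqP A0; apply/matrixP => i j; rewrite mxE; move: A0.
rewrite psumr_eq0; last first.
  by move=> k _; apply: sumr_ge0 => l _; rewrite -expr2 sqr_ge0.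
move=> /allP /(_ i); rewrite mem_index_enum => /(_ erefl).
rewrite psumr_eq0; last by move=> l _; rewrite -expr2 sqr_ge0.
move=> /allP /(_ j); rewrite mem_index_enum => /(_ erefl).
by rewrite mulf_eq0 orbb => /eqP.
Qed.

Lemma ip_CauchySchwarz m n (A B : 'M[R]_(m, n)) :
  ip A B ^+ 2 <= ip A A * ip B B.
Proof.
have [B0|B0] := eqVneq (ip B B) 0.
  by rewrite (ip_eq0 B0) (ipC A) !ip0l expr0n mulr0.
have Bp : 0 < ip B B by rewrite lt_def B0 ip_ge0.
have := ip_ge0 (ip B B *: A - ip A B *: B).
rewrite !ip_bilin (ipC B A) => H.
rewrite -(ler_pM2l Bp) -subr_ge0; apply: le_trans H _.
rewrite le_eqVlt; apply/orP; left; apply/eqP; ring.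
Qed.

Lemma ip_young m n a (A B : 'M[R]_(m, n)) : 0 < a ->
  ip (A + B) (A + B) <= (1 + a) * ip A A + (1 + a^-1) * ip B B.
Proof.
move=> a0; have H := mulr_ge0 (ltW a0) (ip_ge0 (A - a^-1 *: B)).
rewrite -subr_ge0; apply: le_trans H _.
rewrite !ip_bilin (ipC B A).
rewrite le_eqVlt; apply/orP; left; apply/eqP; field.
by rewrite gt_eqF.
Qed.

Lemma ip_mulmxl m n k (M : 'M[R]_(m, n)) (A : 'M[R]_(n, k)) (B : 'M[R]_(m, k)) :
  ip (M *m A) B = ip A (M^T *m B).
Proof.
rewrite /ip; under eq_bigr => i _ do under eq_bigr => j _ do
  rewrite mxE mulr_suml.
under [RHS]eq_bigr => i _ do under eq_bigr => j _ do rewrite mxE mulr_sumr.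
rewrite exchange_big [RHS]exchange_big; apply: eq_bigr => j _.
rewrite exchange_big; apply: eq_bigr => i _; apply: eq_bigr => l _.
by rewrite !mxE mulrCA mulrA.
Qed.

Lemma ip_col m n (A B : 'M[R]_(m, n)) : ip A B = \sum_j ip (col j A) (col j B).
Proof.
rewrite /ip exchange_big; apply: eq_bigr => j _; apply: eq_bigr => i _.
by rewrite big_ord1 !mxE.
Qed.

Lemma ip_row m n (A B : 'M[R]_(m, n)) : ip A B = \sum_i ip (row i A) (row i B).
Proof.
rewrite /ip; apply: eq_bigr => j _; rewrite big_ord1.
by apply: eq_bigr => i _; rewrite !mxE.
Qed.

(** Cauchy-Schwarz on each row. This crude Frobenius bound makes the supremum in [spectral_norm]
    finite and preserves square integrability under left multiplication. *)
Lemma ip_mulmx_le m n (M : 'M[R]_(m, n)) (v : 'cV[R]_n) :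
  ip (M *m v) (M *m v) <= ip M M * ip v v.
Proof.
rewrite (ip_row M M) mulr_suml; apply: ler_sum => i _.
rewrite big_ord1 mxE -expr2; set x := \sum_j _.
suff -> : x = ip (row i M) v^T.
  suff -> : ip v v = ip v^T v^T by exact: ip_CauchySchwarz.
  by rewrite {2}/ip exchange_big; apply: eq_bigr => k _; apply: eq_bigr => l _;
     rewrite !mxE.
by rewrite /ip big_ord1; apply: eq_bigr => j _; rewrite !mxE.
Qed.

Lemma ip_mulmx_spectral m n k (M : 'M[R]_(m, n)) (Z : 'M[R]_(n, k)) :
  ip (M *m Z) (M *m Z) <= spectral_norm M ^+ 2 * ip Z Z.
Proof.
suff H (v : 'cV[R]_n) : ip (M *m v) (M *m v) <= spectral_norm M ^+ 2 * ip v v.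
  rewrite !ip_col mulr_sumr; apply: ler_sum => j _.
  have -> : col j (M *m Z) = M *m col j Z by rewrite !colE mulmxA.
  exact: H.
have [v0|v0] := eqVneq (ip v v) 0.
  by rewrite (ip_eq0 v0) mulmx0 !ip0l mulr0.
have vp : 0 < fnorm v.
  by rewrite lt_def fnorm_ge0 andbT -sqrf_eq0 fnorm_sq.
have [u u1 ->] : exists2 u, ip u u = 1 & v = fnorm v *: u.
  exists ((fnorm v)^-1 *: v); last by rewrite scalerA divff ?gt_eqF// scale1r.
  by rewrite ipZl ipZr -fnorm_sq; field; rewrite gt_eqF.
rewrite -scalemxAr !(ipZl, ipZr) u1 mulr1.
rewrite [leLHS]mulrA [leRHS]mulrC ler_pM2l ?mulr_gt0//.
have Mu : fnorm (M *m u) <= spectral_norm M.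
  apply: ub_le_sup; last first.
    by exists u => //=; rewrite -(@expr_le1 _ 2) ?fnorm_ge0// fnorm_sq u1.
  (* [sup] is only meaningful for a bounded set; the Frobenius norm of [M] is a bound. *)
  exists (fnorm M) => _ [w /= w1 <-].
  rewrite -(@ler_pXn2r _ 2) ?nnegrE ?fnorm_ge0// !fnorm_sq.
  apply: le_trans (ip_mulmx_le _ _) _.
  by rewrite ler_piMr ?ip_ge0// -fnorm_sq expr_le1 ?fnorm_ge0.
rewrite -fnorm_sq ler_pXn2r ?nnegrE ?fnorm_ge0//.
exact: le_trans (fnorm_ge0 _) Mu.
Qed.

End InnerProduct.

Section Averaging.
Variables (R : realType) (n : nat) (n_gt0 : (0 < n)%N).
Notation J := (Jmx R n).
Notation Pi := (1%:M - Jmx R n).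

Lemma n_neq0 : n%:R != 0 :> R.
Proof. by rewrite pnatr_eq0 -lt0n. Qed.

Lemma JmxE i j : J i j = n%:R^-1.
Proof. by rewrite !mxE big_ord1 !mxE mulr1 mulr1. Qed.

Lemma Jmx_tr : J^T = J.
Proof. by apply/matrixP => i j; rewrite mxE !JmxE. Qed.

Lemma ones_avg p (X : 'M[R]_(n, p)) : ones R n *m avg X = J *m X.
Proof. by rewrite /avg /Jmx -scalemxAr mulmxA scalemxAl. Qed.

Lemma JmxK : J *m J = J.
Proof.
apply/matrixP => i j; rewrite mxE.
under eq_bigr => k _ do rewrite !JmxE.
rewrite sumr_const card_ord !JmxE -[LHS]mulr_natr -mulrA mulVf ?mulr1 //.
exact: n_neq0.
Qed.

Lemma JPi0 : J *m Pi = 0.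
Proof. by rewrite mulmxBr mulmx1 JmxK subrr. Qed.

Section Proj.
Variable p : nat.
Implicit Types A B : 'M[R]_(n, p).

Lemma ip_Jl A B : ip (J *m A) B = ip A (J *m B).
Proof. by rewrite ip_mulmxl Jmx_tr. Qed.

Lemma ip_JPi A B : ip (J *m A) (Pi *m B) = 0.
Proof. by rewrite ip_Jl mulmxA JPi0 mul0mx ipC ip0l. Qed.

Lemma JPi_split A : A = J *m A + Pi *m A.
Proof. by rewrite mulmxBl mul1mx addrC subrK. Qed.

Lemma ip_split A B : ip A B = ip (J *m A) (J *m B) + ip (Pi *m A) (Pi *m B).
Proof.
rewrite {1}(JPi_split A) {1}(JPi_split B) ipDl !ipDr ip_JPi (ipC (Pi *m A)).
by rewrite ip_JPi addr0 add0r.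
Qed.

End Proj.

Section Mixing.
Variables (W : 'M[R]_n) (W_ds : doubly_stochastic W).

Lemma ds_WJ : W *m J = J.
Proof. by case: W_ds => W1 _ _; rewrite /Jmx -scalemxAr mulmxA W1. Qed.

Lemma ds_JW : J *m W = J.
Proof. by case: W_ds => _ W1 _; rewrite /Jmx -scalemxAl -mulmxA W1. Qed.

Lemma ds_expJ d : (W ^+ d) *m J = J.
Proof.
elim: d => [|d IH]; first by rewrite expr0 mul1mx.
by rewrite exprS -mulmxA IH ds_WJ.
Qed.

Lemma ds_Jexp d : J *m (W ^+ d) = J.
Proof.
elim: d => [|d IH]; first by rewrite expr0 mulmx1.
by rewrite exprSr mulmxA IH ds_JW.
Qed.

Lemma ds_exp_ge0 d i j : 0 <= (W ^+ d) i j.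
Proof.
case: W_ds => _ _ W0.
elim: d i j => [|d IH] i j; first by rewrite expr0 mxE ler0n.
by rewrite exprS mxE; apply: sumr_ge0 => k _; rewrite mulr_ge0.
Qed.

(** Since [W J = J W = J J = J], all mixed products collapse to [J]. The shift avoids exponent 0,
    where the sides would be [1 - J] and [1]. *)
Lemma ds_subJ_exp d : W ^+ d.+1 - J = (W - J) ^+ d.+1.
Proof.
elim: d => [|d IH]; first by rewrite !expr1.
rewrite [RHS]exprS -IH; transitivity ((W - J) *m (W ^+ d.+1 - J)); last by [].
by rewrite mulmxBl !mulmxBr ds_WJ ds_Jexp JmxK subrr subr0 [in LHS]exprS.
Qed.

Lemma rho_ge0 : 0 <= rho W.
Proof. exact: sqr_ge0. Qed.

Lemma ip_subJ_exp_le d p (Z : 'M[R]_(n, p)) :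
  ip ((W - J) ^+ d *m Z) ((W - J) ^+ d *m Z) <= rho W ^+ d * ip Z Z.
Proof.
elim: d => [|d IH]; first by rewrite !expr0 mul1mx mul1r.
have -> : (W - J) ^+ d.+1 *m Z = (W - J) *m ((W - J) ^+ d *m Z).
  by rewrite mulmxA exprS.
rewrite [rho W ^+ _]exprS -mulrA.
apply: le_trans (ip_mulmx_spectral _ _) _.
by rewrite ler_wpM2l ?sqr_ge0.
Qed.

(** [W ^+ d] commutes with [Pi] and acts as [(W - J) ^+ d] on its range, so each factor costs one
    [rho W]. *)
Lemma ds_mix_le d p (Z : 'M[R]_(n, p)) : (0 < d)%N ->
  ip (Pi *m (W ^+ d *m Z)) (Pi *m (W ^+ d *m Z))
    <= rho W ^+ d * ip (Pi *m Z) (Pi *m Z).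
Proof.
case: d => // d _.
suff -> : Pi *m (W ^+ d.+1 *m Z) = (W - J) ^+ d.+1 *m (Pi *m Z).
  exact: ip_subJ_exp_le.
rewrite !mulmxA; congr (_ *m _).
by rewrite -ds_subJ_exp mulmxBl mul1mx ds_Jexp mulmxBr mulmx1 mulmxBl
  ds_expJ JmxK subrr subr0.
Qed.

Lemma ds_nonexp d p (Z : 'M[R]_(n, p)) : rho W <= 1 -> (0 < d)%N ->
  ip (W ^+ d *m Z) (W ^+ d *m Z) <= ip Z Z.
Proof.
move=> r1 d0; rewrite ip_split [leRHS]ip_split mulmxA ds_Jexp lerD2l.
apply: le_trans (ds_mix_le _ d0) _.
by rewrite ler_piMl ?ip_ge0// exprn_ile1// rho_ge0.
Qed.

(** Mixing preserves the average, so the displacement is a difference of two vectors in the range of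
    [Pi], each of norm at most that of [Pi *m Z]. *)
Lemma ds_drift_le d p (Z : 'M[R]_(n, p)) : rho W <= 1 -> (0 < d)%N ->
  ip (W ^+ d *m Z - Z) (W ^+ d *m Z - Z) <= 4 * ip (Pi *m Z) (Pi *m Z).
Proof.
move=> r1 d0.
have -> : W ^+ d *m Z - Z = Pi *m (W ^+ d *m Z) + - (Pi *m Z).
  have PiE (A : 'M[R]_(n, p)) : Pi *m A = A - J *m A by rewrite mulmxBl mul1mx.
  by rewrite !PiE (mulmxA J) ds_Jexp opprB addrA subrK.
apply: le_trans (@ip_young _ _ _ 1 _ _ _) _ => //.
rewrite ipNl ipNr opprK invr1.
have := ds_mix_le Z d0.
have := ip_ge0 (Pi *m Z).
have : rho W ^+ d <= 1 by rewrite exprn_ile1// rho_ge0.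
nra.
Qed.

End Mixing.
End Averaging.

(** * Smooth and convex functions *)

Section SmoothConvex.
Variables (R : realType) (p : nat).
Implicit Types (f : 'rV[R]_p -> R) (x y : 'rV[R]_p).

Lemma derive_grad f x v : differentiable (f : 'rV[R]_p -> R^o) x ->
  'D_v (f : 'rV[R]_p -> R^o) x = ip (grad f x) v.
Proof.
move=> df; rewrite deriveE// [in LHS](row_sum_delta v) linear_sum /ip big_ord1.
by apply: eq_bigr => j _; rewrite linearZ /= mxE deriveE// mulrC.
Qed.

Lemma is_derive_segment f x v (t : R) : differentiable_everywhere f ->
  is_derive t 1 (fun s : R => f (x + s *: v) : R^o)
    (ip (grad f (x + t *: v)) v).
Proof.
move=> df; rewrite -derive_grad; last exact: df.
have dd := @diff_derivable _ _ _ _ _ v (df (x + t *: v)).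
have E : (fun h : R => h^-1 *: ((f \o shift (x + t *: v)) (h *: v) -
      f (x + t *: v)) : R^o) =
    (fun h : R => h^-1 *: (((fun s : R => f (x + s *: v)) \o shift t) (h *: 1) -
      f (x + t *: v)) : R^o).
  apply/funext => h /=; congr (_ *: (f _ - _)).
  by rewrite [_%:A]mulr1 scalerDl addrCA.
by split; [rewrite /derivable -E|rewrite /derive -E].
Qed.

Lemma smooth_descent f (L : R) x y : 0 <= L -> smooth L f ->
  f y <= f x + ip (grad f x) (y - x) + L / 2 * ip (y - x) (y - x).
Proof.
move=> L0 [df Lf]; set v := y - x.
pose g := fun s : R => f (x + s *: v) : R^o.
pose h := fun s : R => s * ip (grad f x) v + s ^+ 2 * (L / 2 * ip v v) : R.
have dg s := is_derive_segment x v s df.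
have dh (s : R) : is_derive s 1 (h : R -> R^o)
    (ip (grad f x) v + 2 * s * (L / 2 * ip v v)).
  by rewrite /h; apply: is_derive_eq; rewrite /GRing.scale /=; ring.
(* The excess over the quadratic model is nonincreasing on [0, 1]: its slope, the inner product of
   [grad f (x + s v) - grad f x] with [v] minus [s L |v|^2], is nonpositive by Cauchy-Schwarz and
   the Lipschitz bound. *)
pose phi := fun s : R => g s - h s : R^o.
have dphi (s : R) : is_derive s 1 phi (ip (grad f (x + s *: v)) v -
    (ip (grad f x) v + 2 * s * (L / 2 * ip v v))).
  exact: is_deriveB.
have : phi 1 <= phi 0.
  apply: (@ler0_derive1_nincr _ phi 0 1) => // s.
  - rewrite in_itv /= => /andP[s0 s1].
    rewrite derive1E derive_val opprD addrA -ipBl subr_le0.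
    have := Lf (x + s *: v) x; rewrite addrAC subrr add0r => H.
    set a := grad _ _ - _ in H *.
    have := ip_CauchySchwarz a v; rewrite -!fnorm_sq -exprMn.
    have sv : fnorm (s *: v) = s * fnorm v.
      apply/eqP; rewrite -(@eqrXn2 _ 2) ?mulr_ge0 ?fnorm_ge0 ?(ltW s0)//.
      by rewrite exprMn !fnorm_sq ipZl ipZr; apply/eqP; ring.
    rewrite sv in H => CS.
    have av : ip a v <= fnorm a * fnorm v.
      apply: le_trans (ler_norm _) _.
      by rewrite -(@ler_pXn2r _ 2) ?nnegrE ?mulr_ge0 ?fnorm_ge0// real_normK
        ?num_real.
    apply: le_trans av _; apply: le_trans (ler_wpM2r (fnorm_ge0 _) H) _.
    by rewrite le_eqVlt; apply/orP; left; apply/eqP; field.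
  - apply: continuous_subspaceT => u.
    exact/differentiable_continuous/derivable1_diffP.
have xv : x + v = y by rewrite /v addrCA subrr addr0.
rewrite /phi /g /h !scale1r scale0r addr0 xv !mul0r expr1n expr0n !mul1r !mul0r.
by lra.
Qed.

(** Convexity bounds the quotient [(f (x + h (y - x)) - f x) / h] by [f y - f x] for small [h > 0];
    the right limit at 0 is the directional derivative. *)
Lemma strongly_convex_grad f (mu : R) x y : 0 <= mu -> strongly_convex mu f ->
  differentiable_everywhere f -> f x + ip (grad f x) (y - x) <= f y.
Proof.
move=> mu0 sc df; rewrite -lerBrDl.
have dg : is_derive (0 : R) 1 (fun s : R => f (x + s *: (y - x)) : R^o)
    (ip (grad f x) (y - x)).
  by have := is_derive_segment x (y - x) 0 df; rewrite scale0r addr0.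
have /cvg_dnbhs_at_right dr := @ex_derive _ _ _ _ _ _ _ dg.
rewrite -(@derive_val _ _ _ _ _ _ _ dg).
apply: (cvgr_to_le dr); near=> h => /=.
have h0 : 0 < h by near: h; exact: nbhs_right_gt.
have h1 : h <= 1 by near: h; apply: nbhs_right_le.
rewrite scale0r !addr0 [_%:A]mulr1 /GRing.scale /= mulrC ler_pdivrMr//.
have := sc y x h; rewrite (ltW h0) h1 => /(_ isT).
have -> : h *: y + (1 - h) *: x = x + h *: (y - x).
  by rewrite scalerBl scale1r scalerBr addrCA addrA addrAC.
have h1' : 0 <= 1 - h by rewrite subr_ge0.
have := mulr_ge0 (mulr_ge0 mu0 (mulr_ge0 (ltW h0) h1'))
  (sqr_ge0 (fnorm (y - x))).
nra.
Unshelve. all: by end_near. Qed.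

End SmoothConvex.

(** * Measurability of gradients at random points *)

Lemma bigI_inP T (I : eqType) (s : seq I) (F : I -> set T) (w : T) :
  (\big[setI/setT]_(i <- s) F i) w <-> (forall i, i \in s -> F i w).
Proof.
elim: s => [|i s IH]; first by rewrite big_nil; split.
rewrite big_cons; split=> [[Fi /IH Fs] k|Fs].
  by rewrite inE => /predU1P[->//|]; exact: Fs.
split; first by apply: Fs; rewrite mem_head.
by apply/IH => k ks; apply: Fs; rewrite inE ks orbT.
Qed.

Section Caratheodory.
Variables (R : realType) (dT : measure_display) (T : measurableType dT)
  (p : nat).
Implicit Types (x : T -> 'rV[R]_p) (h : 'rV[R]_p -> T -> R).

Definition grid_point (m : nat) (z : 'rV[R]_p) : 'rV[R]_p :=
  \row_j ((Num.floor (m.+1%:R * z 0 j))%:~R / m.+1%:R).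

Lemma grid_point_cvg (z : 'rV[R]_p) : (grid_point m z) @[m --> \oo] --> z.
Proof.
apply/cvgrPdist_le => e e0; near=> m.
have me : m.+1%:R^-1 <= e by apply: ltW; near: m;
  exact: (near_infty_natSinv_lt (PosNum e0)).
apply: le_trans me; rewrite /Num.norm /= mx_normrE.
apply: bigmax_le => [|[i j] _]; first by rewrite invr_ge0.
rewrite !mxE /= !ord1; set t := z 0 j.
have m0 : 0 < m.+1%:R :> R by [].
have -> : t - (Num.floor (m.+1%:R * t))%:~R / m.+1%:R =
  (m.+1%:R * t - (Num.floor (m.+1%:R * t))%:~R) / m.+1%:R.
  by field; rewrite gt_eqF.
have /andP[f1 f2] := floor_itv (m.+1%:R * t).
rewrite normrM [X in _ * X]gtr0_norm ?invr_gt0// ler_piMl ?invr_ge0//.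
rewrite ger0_norm ?subr_ge0// lerBlDr; apply: ltW.
by move: f2; rewrite intrD addrC.
Unshelve. all: by end_near. Qed.

(** Rounding [x w] down to a grid of mesh [1 / (m + 1)] leaves countably many values, on each of
    which only measurability of [h] at a fixed point is used. Continuity in the first argument then
    gives the pointwise limit. *)
Lemma measurable_caratheodory x h :
  (forall j, measurable_fun setT (fun w => x w 0 j)) ->
  (forall z, measurable_fun setT (h z)) -> (forall w, continuous (h ^~ w)) ->
  measurable_fun setT (fun w => h (x w) w).
Proof.
move=> mx mh ch.
apply: (@measurable_fun_cvg _ _ _ _ (fun m w => h (grid_point m (x w)) w)).
  move=> m _ Y mY; rewrite setTI.
  (* A grid point is indexed by its integer numerators, so the preimage splits into a countable
     union over integer vectors [c]. *)
  pose gp (c : 'rV[int]_p) : 'rV[R]_p := \row_j ((c 0 j)%:~R / m.+1%:R).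
  have -> : (fun w => h (grid_point m (x w)) w) @^-1` Y =
    \bigcup_(c : 'rV[int]_p) (\big[setI/setT]_(j < p)
      ((fun w => x w 0 j) @^-1` [set t | c 0 j <= Num.floor (m.+1%:R * t) <= c
        0 j]%R)
      `&` (h (gp c) @^-1` Y)).
    apply/seteqP; split => w /=.
      move=> Yw; exists (\row_j Num.floor (m.+1%:R * x w 0 j)) => //; split.
        by apply/bigI_inP => j _ /=; rewrite mxE lexx.
      rewrite /gp; move: Yw; congr (Y (h _ w)).
      by apply/rowP => j; rewrite !mxE.
    move=> [c _ []]; move=> /bigI_inP cx; congr (Y (h _ w)).
    apply/rowP => j; rewrite !mxE; congr (_%:~R / _).
    by apply/eqP; rewrite eq_le; have := cx j (mem_index_enum _).
  apply: countable_bigcupT_measurable; first exact: countableP.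
  move=> c; apply: measurableI; last by rewrite -[X in measurable X]setTI;
    exact: mh.
  apply: bigsetI_measurable => j _; rewrite -[X in measurable X]setTI.
  apply: mx => //.
  have -> : [set t | c 0 j <= Num.floor (m.+1%:R * t) <= c 0 j]%R =
    `[(c 0 j)%:~R / m.+1%:R, (c 0 j + 1)%:~R / m.+1%:R[%classic :> set R.
    apply/seteqP; split => t /=; rewrite in_itv /=.
      by rewrite ler_pdivrMr// ltr_pdivlMr// !(mulrC t) -floor_ge_int
        -floor_lt_int ltzD1.
    by rewrite ler_pdivrMr// ltr_pdivlMr// !(mulrC t) -floor_ge_int
        -floor_lt_int ltzD1.
  exact: measurable_itv.
by move=> w _; exact: (cvg_comp _ _ (@grid_point_cvg (x w)) (ch w (x w))).
Qed.

(** A partial derivative is the limit of difference quotients of step [1 / (m + 1)], each measurable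
    by the Caratheodory argument. *)
Lemma measurable_grad x h j :
  (forall k, measurable_fun setT (fun w => x w 0 k)) ->
  (forall z, measurable_fun setT (h z)) ->
  (forall w, differentiable_everywhere (h ^~ w)) ->
  measurable_fun setT (fun w => grad (h ^~ w) (x w) 0 j).
Proof.
move=> mx mh dh.
have ch w : continuous (h ^~ w : 'rV[R]_p -> R^o).
  by move=> z; exact/differentiable_continuous/dh.
pose v m : 'rV[R]_p := m.+1%:R^-1 *: delta_mx 0 j.
apply: (@measurable_fun_cvg _ _ _ _
  (fun m w => m.+1%:R * (h (v m + x w) w - h (x w) w))).
  move=> m; apply: measurable_funM => //; apply: measurable_funB.
    apply: (@measurable_caratheodory (fun w => v m + x w)) => // k.
    under eq_fun do rewrite mxE.
    by apply: measurable_funD.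
  exact: measurable_caratheodory.
move=> w _; rewrite mxE.
have /cvg_dnbhs_at_right/cvg_at_rightP dr := @diff_derivable _ _ _ _ _
  (delta_mx 0 j) (dh w (x w)).
have := dr (fun m => m.+1%:R^-1); rewrite /GRing.scale /= => H.
under eq_fun do rewrite -[X in X * _]invrK.
by apply: H; split => //; exact: cvg_harmonic.
Qed.

End Caratheodory.

(** * Independence and freezing *)

Section Freezing.
Variables (R : realType) (dO : measure_display) (Omega : measurableType dO).
Variable P : probability Omega R.
Variables (I : choiceType) (d : I -> measure_display).
Variables (T : forall i, measurableType (d i)) (Z : forall i, {RV P >-> T i}).
Hypothesis Z_indep : mutually_independent Z.
Variable k : I.

(* A pi-system generating the sigma-algebra of all the [Z i] with [i != k]. By
   independence, the law of [(w, Z k w)] is a product measure when [w] is only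
   observed through that sigma-algebra, so that Fubini's theorem replaces
   conditional expectations. *)
Definition others : set (set Omega) :=
  [set C | exists s (A : forall i, set (T i)), [/\ uniq s, k \notin s,
     forall i, measurable (A i) & C = \big[setI/setT]_(i <- s)
       (Z i @^-1` A i)]].

Lemma others_setI_closed : setI_closed others.
Proof.
move=> C1 C2 [s1 [A1 [u1 k1 m1 ->]]] [s2 [A2 [u2 k2 m2 ->]]].
(* An index missing from one of the lists is given the full space there, so the two families can be
   intersected over the merged list. *)
pose A i := (if i \in s1 then A1 i else setT) `&`
            (if i \in s2 then A2 i else setT).
exists (undup (s1 ++ s2)), A; split.
- exact: undup_uniq.
- by rewrite mem_undup mem_cat negb_or k1.
- by move=> i; apply: measurableI; case: ifP.
apply/seteqP; split => w.
  move=> [/bigI_inP w1 /bigI_inP w2]; apply/bigI_inP => i _.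
  by split; case: ifP => //; [exact: w1 | exact: w2].
move/bigI_inP => wA; split; apply/bigI_inP => i si.
  have : i \in undup (s1 ++ s2) by rewrite mem_undup mem_cat si.
  by move=> /wA [] /=; rewrite si.
have : i \in undup (s1 ++ s2) by rewrite mem_undup mem_cat si orbT.
by move=> /wA [] _ /=; rewrite si.
Qed.

Lemma measurable_preimageZ i (A : set (T i)) : measurable A ->
  measurable (Z i @^-1` A).
Proof. by move=> mA; rewrite -[X in measurable X]setTI;
  exact: measurable_funPT. Qed.

Lemma others_measurable : others `<=` measurable.
Proof.
move=> _ [s [A [_ _ mA ->]]]; apply: bigsetI_measurable => i _.
exact: measurable_preimageZ.
Qed.

Lemma others_setT : others setT.
Proof. by exists [::], (fun=> setT); split => //; rewrite big_nil. Qed.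

Lemma others_mem i (A : set (T i)) : i != k -> measurable A ->
  others (Z i @^-1` A).
Proof.
move=> ik mA.
(* The type of the set depends on the index, so [A] has to be transported along [i = j]; decidable
   equality of indices makes the transport trivial. *)
pose B j : set (T j) := if pselect (i = j) is left e then
  eq_rect i (fun j => set (T j)) A j e else setT.
exists [:: i], B; split => //.
- by rewrite inE eq_sym.
- by move=> j; rewrite /B; case: pselect => // e; subst j.
rewrite big_seq1 /B; case: pselect => // e.
by rewrite -(Eqdep_dec.eq_rect_eq_dec (@eq_comparable I)).
Qed.

(** As functions of [C], both sides are finite measures: a restriction and a multiple of [P]. Mutual
    independence over [k :: s] makes them agree on the pi-system, hence on the sigma-algebra it
    generates. *)
Lemma others_indep C (B : set (T k)) : <<s others >> C -> measurable B ->
  P (C `&` (Z k @^-1` B)) = (P C * P (Z k @^-1` B))%E.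
Proof.
move=> sC mB; have mZB := measurable_preimageZ mB.
have r0 : 0 <= fine (P (Z k @^-1` B)) by rewrite fine_ge0.
pose m1 : {measure set Omega -> \bar R} := mrestr P mZB.
pose m2 : {measure set Omega -> \bar R} := mscale (NngNum r0) P.
have := @g_sigma_algebra_measure_unique _ R Omega others others_measurable
  (fun=> setT) (fun=> others_setT) _ m1 m2 others_setI_closed.
rewrite /m1 /m2 /= /mrestr /mscale /= => ->//.
- by rewrite muleC fineK// fin_num_measure.
- by rewrite bigcup_const.
- move=> _ [s [A [us ks mA ->]]].
  rewrite fineK ?fin_num_measure//.
  pose A' j : set (T j) := if pselect (k = j) is left e then
    eq_rect k (fun j => set (T j)) B j e else A j.
  have A's i : i \in s -> A' i = A i.
    move=> si; rewrite /A'; case: pselect => // e.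
    by exfalso; move: ks; rewrite {1}e si.
  have A'k : A' k = B.
    rewrite /A'; case: pselect => // e.
    by rewrite -(Eqdep_dec.eq_rect_eq_dec (@eq_comparable I)).
  have := @Z_indep (k :: s) A'; rewrite !big_cons A'k /= ks us => /(_ isT).
  have <- : \big[setI/setT]_(i <- s) (Z i @^-1` A' i) =
      \big[setI/setT]_(i <- s) (Z i @^-1` A i).
    by apply: eq_big_seq => i si; rewrite A's.
  have := @Z_indep s A' us; move=> ->.
  rewrite setIC; apply.
    by move=> i; rewrite /A'; case: pselect => // e; subst i.
  by move=> i; rewrite /A'; case: pselect => // e; subst i.
- by move=> _; rewrite ltey_eq fin_num_measure//; exact: measurableI.
Qed.

Notation Omega_k := (g_sigma_algebraType others).

Lemma measurable_id_others : measurable_fun setT (id : Omega -> Omega_k).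
Proof.
move=> _ C mC; rewrite setTI preimage_id.
by apply: (smallest_sub _ others_measurable) mC;
  exact: sigma_algebra_measurable.
Qed.

Lemma measurable_others i : i != k ->
  measurable_fun setT (Z i : Omega_k -> T i).
Proof.
move=> ik _ A mA; rewrite setTI.
by apply: sub_sigma_algebra; exact: others_mem.
Qed.

(** The target carries the coarser sigma-algebra; a named map is what a measurable structure, and
    hence an image law, can be attached to. *)
Definition id_others (w : Omega) : Omega_k := w.

HB.instance Definition _ :=
  isMeasurableFun.Build _ _ _ _ id_others measurable_id_others.

Definition joint_others (w : Omega) : Omega_k * T k := (w, Z k w).

Lemma measurable_joint_others : measurable_fun setT joint_others.
Proof.
apply: measurable_fun_pair; first exact: measurable_id_others.
exact: measurable_funPT.
Qed.

HB.instance Definition _ :=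
  isMeasurableFun.Build _ _ _ _ joint_others measurable_joint_others.

Variable D : probability (T k) R.
Hypothesis Z_law : forall A, measurable A -> distribution P (Z k) A = D A.

Lemma joint_others_law (S : set (Omega_k * T k)) : measurable S ->
  (distribution P id_others \x D)%E S = distribution P joint_others S.
Proof.
move=> mS; apply: product_measure_unique => // A B mA mB.
transitivity (P A * P (Z k @^-1` B))%E; first exact: others_indep.
by congr (_ * _)%E; exact: Z_law.
Qed.

Local Open Scope ereal_scope.

Lemma integral_joint_others (H : Omega_k * T k -> \bar R) :
  \int[distribution P joint_others]_x H x =
  \int[distribution P id_others \x D]_x H x.
Proof.
apply: eq_measure_integral => A mA _.
exact/esym/joint_others_law.
Qed.

(** Tonelli under the product law. Measurability of [H] on [Omega_k * T k] says that its first
    argument is seen only through the other samples, so the inner integral plays the role of a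
    conditional expectation. *)
Lemma ge0_integral_freeze (H : Omega_k * T k -> \bar R) :
  measurable_fun setT H -> (forall x, 0 <= H x) ->
  \int[P]_w H (w, Z k w) = \int[P]_w \int[D]_s H (w, s).
Proof.
move=> mH H0.
transitivity (\int[distribution P joint_others]_x H x).
  by rewrite ge0_integral_pushforward.
transitivity (\int[distribution P id_others \x D]_x H x).
  exact: integral_joint_others.
rewrite fubini_tonelli1// ge0_integral_pushforward//.
  exact: measurable_fun_fubini_tonelli_F.
by move=> w _; apply: integral_ge0 => s _; exact: H0.
Qed.

Lemma integral_freeze (H : Omega_k * T k -> \bar R) :
  measurable_fun setT H -> P.-integrable setT (fun w => H (w, Z k w)) ->
  \int[P]_w H (w, Z k w) = \int[P]_w \int[D]_s H (w, s).
Proof.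
move=> mH iH.
(* Fubini for signed [H] requires integrability under the product law; it is carried over from [P]
   through the joint law, which is the same measure. *)
have iJ : (distribution P joint_others).-integrable setT H.
  exact: integrable_pushforward.
have iJ' : (distribution P id_others \x D).-integrable setT H.
  apply/integrableP; split => //; move/integrableP : iJ => [_].
  by rewrite (integral_joint_others (abse \o H)).
transitivity (\int[distribution P joint_others]_x H x).
  by rewrite integral_pushforward.
transitivity (\int[distribution P id_others \x D]_x H x).
  exact: integral_joint_others.
rewrite -integral12_prod_meas1//.
have mF := measurable_fubini_F iJ'.
have /integrableP[_ Foo] := integrable_fubini_F iJ'.
rewrite integral_pushforward//; apply/integrableP; split.
  exact: measurableT_comp mF measurable_id_others.
by move: Foo; rewrite ge0_integral_pushforward//; exact: measurableT_comp.
Qed.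

End Freezing.

(** * Square-integrable random matrices *)

Section SquareIntegrable.
Variables (R : realType) (dO : measure_display) (Omega : measurableType dO).
Variable P : probability Omega R.

Lemma integrable_mul_sq (f g : Omega -> R) :
  measurable_fun setT f -> measurable_fun setT g ->
  P.-integrable setT (fun w => (f w ^+ 2)%:E) ->
  P.-integrable setT (fun w => (g w ^+ 2)%:E) ->
  P.-integrable setT (fun w => (f w * g w)%:E).
Proof.
move=> mf mg f2 g2; apply: le_integrable (integrableD _ f2 g2) => //.
  by apply/measurable_EFinP; exact: measurable_funM.
move=> w _ /=; rewrite lee_fin [leRHS]ger0_norm ?addr_ge0 ?sqr_ge0// normrM.
rewrite -(real_normK (num_real (f w))) -(real_normK (num_real (g w))).
by have := sqr_ge0 (`|f w| - `|g w|); have := sqr_ge0 (`|f w| + `|g w|); nra.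
Qed.

Lemma integrable_sq (f : Omega -> R) :
  measurable_fun setT f -> P.-integrable setT (fun w => (f w ^+ 2)%:E) ->
  P.-integrable setT (EFin \o f).
Proof.
move=> mf f2; have := @integrable_mul_sq f (cst 1) mf _ f2.
under [X in _ -> _ -> integrable _ _ X]eq_fun do rewrite mulr1.
apply; first by [].
under eq_fun do rewrite expr1n; exact: finite_measure_integrable_cst.
Qed.

Variables n p : nat.
Implicit Types A B : Omega -> 'M[R]_(n, p).

Definition sqint A : Prop := forall i j,
  measurable_fun setT (fun w => A w i j) /\
  P.-integrable setT (fun w => (A w i j ^+ 2)%:E).

Lemma sqint_lin a A B : sqint A -> sqint B -> sqint (fun w => a *: A w + B w).
Proof.
move=> sA sB i j; have [[mA iA] [mB iB]] := (sA i j, sB i j); split.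
  under eq_fun do rewrite !mxE; apply: measurable_funD => //.
  exact: measurable_funM.
have := integrableD _ (integrableZl _ (a ^+ 2) iA)
  (integrableD _ (integrableZl _ (2 * a) (integrable_mul_sq mA mB iA iB)) iB).
move=> /(_ measurableT measurableT measurableT measurableT).
apply: eq_integrable => // w _; rewrite !mxE /= -!EFinM -!EFinD; congr EFin.
ring.
Qed.

Lemma sqint_cst (M : 'M[R]_(n, p)) : sqint (fun=> M).
Proof. by move=> i j; split => //; exact: finite_measure_integrable_cst. Qed.

Lemma sqint_le A (g : Omega -> R) :
  (forall i j, measurable_fun setT (fun w => A w i j)) ->
  P.-integrable setT (EFin \o g) -> (forall w, ip (A w)
    (A w) <= g w) -> sqint A.
Proof.
move=> mA ig Ag i j; split => //; apply: le_integrable ig => //.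
  by apply/measurable_EFinP; exact: measurable_funX.
move=> w _ /=; rewrite lee_fin ger0_norm ?sqr_ge0//.
apply: le_trans (ler_norm _); apply: le_trans (Ag w).
rewrite /ip (bigD1 i)//= (bigD1 j)//= -expr2 -addrA lerDl addr_ge0//.
  by apply: sumr_ge0 => k _; rewrite -expr2 sqr_ge0.
by apply: sumr_ge0 => k _; apply: sumr_ge0 => l _; rewrite -expr2 sqr_ge0.
Qed.

Lemma integrable_ip A B : sqint A -> sqint B ->
  P.-integrable setT (fun w => (ip (A w) (B w))%:E).
Proof.
move=> sA sB; rewrite /ip.
under eq_fun do (rewrite -sumEFin; under eq_bigr do rewrite -sumEFin).
apply: integrable_sum => // i _; apply: integrable_sum => // j _.
have [[mA iA] [mB iB]] := (sA i j, sB i j); exact: integrable_mul_sq.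
Qed.

Definition sqint_pred : {pred Omega -> 'M[R]_(n, p)} := fun A => `[< sqint A >].

Lemma sqint_submod_closed : submod_closed sqint_pred.
Proof.
split; first by apply/asboolP; exact: sqint_cst.
by move=> a A B /asboolP sA /asboolP sB; apply/asboolP; exact: sqint_lin.
Qed.

HB.instance Definition _ := GRing.isSubmodClosed.Build R _ sqint_pred
  sqint_submod_closed.

(** Functions are not identified up to null sets: equations between iterates stay pointwise, and
    [Eip] is only positive semidefinite. *)
Record L2 := MkL2 { l2fun :> Omega -> 'M[R]_(n, p); _ : l2fun \in sqint_pred }.

HB.instance Definition _ := [isSub for l2fun].
HB.instance Definition _ := [Choice of L2 by <:].
HB.instance Definition _ := [SubChoice_isSubLmodule of L2 by <:].

Lemma L2_sqint (A : L2) : sqint A.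
Proof. by case: A => A /= /asboolP. Qed.

Definition mkL2 A (sA : sqint A) : L2 := @MkL2 A (introT (asboolP _) sA).

Lemma L2DE (A B : L2) w : (A + B) w = A w + B w. Proof. by []. Qed.
Lemma L2NE (A : L2) w : (- A) w = - A w. Proof. by []. Qed.
Lemma L2_sumE I (r : seq I) (A : I -> L2) w :
  (\sum_(i <- r) A i) w = \sum_(i <- r) A i w.
Proof.
by elim: r => [|i r IH]; rewrite ?big_nil// !big_cons L2DE IH.
Qed.

Lemma L2P (A B : L2) : (forall w, A w = B w) -> A = B.
Proof. by move=> AB; apply/val_inj/funext. Qed.

Definition Eip (A B : L2) : R := (\int[P]_w ip (A w) (B w))%R.

Lemma EipC (A B : L2) : Eip A B = Eip B A.
Proof. by rewrite /Eip; under eq_Rintegral do rewrite ipC. Qed.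

Lemma EipDl (A B C : L2) : Eip (A + B) C = Eip A C + Eip B C.
Proof.
rewrite /Eip -RintegralD//; try exact: integrable_ip (L2_sqint _) (L2_sqint _).
by apply: eq_Rintegral => w _; rewrite ipDl.
Qed.

Lemma EipZl a (A B : L2) : Eip (a *: A) B = a * Eip A B.
Proof.
rewrite /Eip -RintegralZl//; last exact: integrable_ip (L2_sqint _)
  (L2_sqint _).
by apply: eq_Rintegral => w _; rewrite ipZl.
Qed.

Lemma Eip_ge0 (A : L2) : 0 <= Eip A A.
Proof. by apply: Rintegral_ge0 => w _; exact: ip_ge0. Qed.

Lemma le_Eip a b (A B C D : L2) :
  (forall w, a * ip (A w) (B w) <= b * ip (C w) (D w)) ->
  a * Eip A B <= b * Eip C D.
Proof.
move=> H; rewrite /Eip -!RintegralZl//;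
  try exact: integrable_ip (L2_sqint _) (L2_sqint _).
apply: le_Rintegral => //.
- exact: (integrableZl _ a (integrable_ip (L2_sqint A) (L2_sqint B))).
- exact: (integrableZl _ b (integrable_ip (L2_sqint C) (L2_sqint D))).
Qed.

Variable M : 'M[R]_n.

Lemma sqint_mul A : sqint A -> sqint (fun w => M *m A w).
Proof.
move=> sA; apply: (@sqint_le _ (fun w => ip M M * ip (A w) (A w))).
- move=> i j; under eq_fun do rewrite mxE; apply: measurable_sum => k.
  by apply: measurable_funM => //; have [] := sA k j.
- exact: (integrableZl _ (ip M M) (integrable_ip sA sA)).
move=> w; rewrite (ip_col (M *m _)) (ip_col (A w)) mulr_sumr; apply: ler_sum =>
  j _.
by have -> : col j (M *m A w) = M *m col j (A w);
  [rewrite !colE mulmxA | exact: ip_mulmx_le].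
Qed.

Definition lmulL2 (A : L2) : L2 := mkL2 (sqint_mul (L2_sqint A)).

Lemma lmulL2_linear : linear lmulL2.
Proof.
by move=> a A B; apply: L2P => w; rewrite /= linearP.
Qed.

HB.instance Definition _ :=
  GRing.isLinear.Build R L2 L2 _ lmulL2 lmulL2_linear.

End SquareIntegrable.

(** * One round in a semi-inner product space *)

(* With q = 1 - rho^d1, the variables A, B, C, e, S, M stand for n times the mean
   squared error, consensus error, tracking error, optimality gap, variance and
   drift over the local steps. Numerals are unary, whence 96 * 97 for 9312 and
   6 * 96 * 97 for 55872. *)
Lemma round_scalar (R : realFieldType)
    (tau L h mu q r m A A' B B' C C' e S M Z noise : R) :
  0 <= tau -> 0 <= L -> h = tau * L -> 10 * h <= 1 -> 0 < q <= 1 -> r = 1 - q ->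
  (153 * h) ^+ 2 * r <= q ^+ 4 ->
  m <= mu * tau / 4 -> m <= q / 8 ->
  0 <= A -> 0 <= B -> 0 <= C -> 0 <= e -> 0 <= S -> 0 <= M -> mu / 4 * A <= e ->
  M <= 5 / 2 * tau ^+ 2 * (C + 3 * S + 2 * L ^+ 2 * B + 4 * L * e) ->
  Z = 5 / 4 * M + 5 * B ->
  A' <= A - 2 * tau * e + h * Z + 4 * h * tau * e + 2 * h ^+ 2 * Z
        + h * M + h * tau ^+ 2 * S + noise ->
  B' <= (1 - q / 2) * B + 6 * r / q * tau ^+ 2 * (C + 3 * S + L ^+ 2 * M) ->
  C' <= (1 - q / 2) * C + 2 * r / q * L ^+ 2 * (5 / 4 * M + 20 * B)
        + 5 * r * S ->
  A' + 192 * h / q * B' + (96 * 97) * tau ^+ 2 * h / q ^+ 3 * C' <=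
  (1 - m) * (A + 192 * h / q * B + (96 * 97) * tau ^+ 2 * h / q ^+ 3 * C)
  + noise + tau ^+ 2 * h / q ^+ 3
    * (36 * q ^+ 3 + (36 * 96) * q * r + (6 * 96 * 97) * r) * S.
Proof.
move=> t0 L0 hE h1 /andP[q0 q1] rE H5 m1 m2 A0 B0 C0 e0 S0 M0 eA HM ZE HA HB HC.
have h0 : 0 <= h by rewrite hE mulr_ge0.
have r0 : 0 <= r by rewrite rE subr_ge0.
have r1 : r <= 1 by lra.
pose v := q^-1; have vq : v * q = 1 by rewrite mulVf ?gt_eqF.
have v1 : 1 <= v by rewrite invf_ge1.
have v0 : 0 <= v by lra.
pose k1 := 192 * h * v; pose k2 := (96 * 97) * tau ^+ 2 * h * v ^+ 3.
have k10 : 0 <= k1 by rewrite /k1 !mulr_ge0.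
have k20 : 0 <= k2 by rewrite /k2 !mulr_ge0 ?exprn_ge0.
have v21 : 1 <= v ^+ 2 by rewrite expr_ge1.
have hv4 : (153 * 153) * h ^+ 2 * r * v ^+ 4 <= 1.
  apply: (@le_trans _ _ (q ^+ 4 * v ^+ 4)); last first.
    by rewrite -exprMn mulrC vq expr1n.
  apply: ler_wpM2r; first exact: exprn_ge0.
  by apply: le_trans H5; rewrite le_eqVlt; apply/orP; left; apply/eqP; ring.
have hv2 : (153 * 153) * h ^+ 2 * r * v ^+ 2 <= 1.
  apply: le_trans hv4; rewrite ler_wpM2l ?mulr_ge0 ?exprn_ge0//.
  by rewrite -[v ^+ 4]/(v ^+ (2 + 2)) exprD ler_peMr ?exprn_ge0.
have hh : h ^+ 2 <= h / 10 by rewrite expr2; nra.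
have HM' : M <= tau ^+ 2 * (5 / 2 * C + 15 / 2 * S) + 5 * h ^+ 2 * B
    + 10 * h * tau * e.
  by apply: le_trans HM _; rewrite hE le_eqVlt; apply/orP; left; apply/eqP;
    field.
(* [71 / 20 = 5 / 2 + 1 / 20 + 1] is the total weight of [h * M] in the three estimates that
   follow. *)
have hM : 71 / 20 * (h * M) <= h * tau ^+ 2 * (9 * C + 27 * S) + h * B / 5
    + 9 / 25 * (tau * e).
  have a1 := ler_wpM2l h0 HM'.
  have a2 : h ^+ 2 * (tau * e) <= 1 / 100 * (tau * e).
    by rewrite ler_wpM2r ?mulr_ge0//; rewrite expr2; nra.
  have a3 : h * (h ^+ 2 * B) <= h * (1 / 100 * B).
    by rewrite ler_wpM2l// ler_wpM2r//; rewrite expr2; nra.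
  have a4 := mulr_ge0 (mulr_ge0 h0 (exprn_ge0 2 t0)) C0.
  have a5 := mulr_ge0 (mulr_ge0 h0 (exprn_ge0 2 t0)) S0.
  have a6 := mulr_ge0 h0 B0.
  have a7 := mulr_ge0 t0 e0.
  have -> : h * tau ^+ 2 * (9 * C + 27 * S) =
    9 * (h * tau ^+ 2 * C) + 27 * (h * tau ^+ 2 * S) by ring.
  have : h * (tau ^+ 2 * (5 / 2 * C + 15 / 2 * S) + 5 * h ^+ 2 * B
    + 10 * h * tau * e) = 5 / 2 * (h * tau ^+ 2 * C) +
    15 / 2 * (h * tau ^+ 2 * S) + 5 * (h * (h ^+ 2 * B)) + 10 * (h ^+ 2 * (tau * e)) by field.
  lra.
have HA' : A' <= A - 2 * (tau * e) + 2 / 5 * (tau * e) + 5 / 2 * (h * M)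
    + 6 * (h * B) + h * tau ^+ 2 * S + noise.
  apply: le_trans HA _; rewrite ZE.
  have a1 : h ^+ 2 * M <= h / 10 * M by rewrite ler_wpM2r.
  have a2 : h ^+ 2 * B <= h / 10 * B by rewrite ler_wpM2r.
  have a3 : 10 * h * (tau * e) <= 1 * (tau * e) by rewrite ler_wpM2r ?mulr_ge0.
  by lra.
have HB' : k1 * B' <= k1 * B - 96 * (h * B)
    + (12 * 96) * (h * tau ^+ 2 * r * v ^+ 2) * (C + 3 * S) + 1 / 20 * (h * M).
  apply: le_trans (ler_wpM2l k10 HB) _.
  have a1 : (153 * 153) * h ^+ 2 * r * v ^+ 2 * (h * M) <= 1 * (h * M).
    by rewrite ler_wpM2r ?mulr_ge0.
  have a2 := mulr_ge0 h0 M0.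
  have -> : k1 * ((1 - q / 2) * B + 6 * r / q * tau ^+ 2 * (C + 3 * S + L ^+ 2
    * M))
    = k1 * B - 96 * (h * B) * (v * q)
      + (12 * 96) * (h * tau ^+ 2 * r * v ^+ 2) * (C + 3 * S)
      + (12 * 96) * (h ^+ 2 * r * v ^+ 2 * (h * M)).
    by rewrite /k1 -/v hE; field.
  by rewrite vq; lra.
have HC' : k2 * C' <= k2 * C - (48 * 97) * (h * tau ^+ 2 * v ^+ 2 * C)
    + (h * M) + 16 * (h * B) + (480 * 97) * (h * tau ^+ 2 * r * v ^+ 3 * S).
  apply: le_trans (ler_wpM2l k20 HC) _.
  (* The origin of 153: [153 ^ 2 = 23409] just exceeds [240 * 97 = 23280], and [16 * 153 ^ 2]
     exceeds [40 * 96 * 97]. *)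
  have a1 : (153 * 153) * h ^+ 2 * r * v ^+ 4 * (h * M) <= 1 * (h * M).
    by rewrite ler_wpM2r ?mulr_ge0.
  have a3 : (153 * 153) * h ^+ 2 * r * v ^+ 4 * (h * B) <= 1 * (h * B).
    by rewrite ler_wpM2r ?mulr_ge0.
  have a2 := mulr_ge0 h0 M0; have a4 := mulr_ge0 h0 B0.
  have -> : k2 * ((1 - q / 2) * C + 2 * r / q * L ^+ 2 * (5 / 4 * M + 20 * B)
        + 5 * r * S)
    = k2 * C - (48 * 97) * (h * tau ^+ 2 * v ^+ 2 * C) * (v * q)
      + (240 * 97) * (h ^+ 2 * r * v ^+ 4 * (h * M))
      + (40 * 96 * 97) * (h ^+ 2 * r * v ^+ 4 * (h * B))
      + (480 * 97) * (h * tau ^+ 2 * r * v ^+ 3 * S).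
    by rewrite /k2 -/v hE; field.
  by rewrite vq; lra.
have -> : 192 * h / q = k1 by [].
have -> : (96 * 97) * tau ^+ 2 * h / q ^+ 3 = k2 by rewrite /k2 exprVn.
have -> : tau ^+ 2 * h / q ^+ 3 * (36 * q ^+ 3 + (36 * 96) * q * r + (6 * 96 *
  97) * r) * S
  = 36 * (h * tau ^+ 2 * S) + (36 * 96) * (h * tau ^+ 2 * r * v ^+ 2 * S)
    + (6 * 96 * 97) * (h * tau ^+ 2 * r * v ^+ 3 * S).
  by rewrite /v; field; rewrite gt_eqF.
have mA : m * A <= tau * e.
  have : m * A <= mu * tau / 4 * A by rewrite ler_wpM2r.
  by have := ler_wpM2l t0 eA; lra.
have mB : m * (k1 * B) <= 24 * (h * B).
  have : m * (k1 * B) <= q / 8 * (k1 * B) by rewrite ler_wpM2r ?mulr_ge0.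
  have -> : q / 8 * (k1 * B) = 24 * (h * B) * (v * q) by rewrite /k1; field.
  by rewrite vq mulr1.
have mC : m * (k2 * C) <= (12 * 97) * (h * tau ^+ 2 * v ^+ 2 * C).
  have : m * (k2 * C) <= q / 8 * (k2 * C) by rewrite ler_wpM2r ?mulr_ge0.
  have -> : q / 8 * (k2 * C) = (12 * 97) * (h * tau ^+ 2 * v ^+ 2 * C)
    * (v * q).
    by rewrite /k2; field.
  by rewrite vq mulr1.
have w0 : 0 <= h * tau ^+ 2 * v ^+ 2 by rewrite !mulr_ge0 ?exprn_ge0.
have p1 : h * tau ^+ 2 * r * v ^+ 2 * C <= h * tau ^+ 2 * v ^+ 2 * C.
  rewrite ler_wpM2r// ler_wpM2r ?exprn_ge0// ler_piMr// mulr_ge0//.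
  exact: exprn_ge0.
have p2 : h * tau ^+ 2 * C <= h * tau ^+ 2 * v ^+ 2 * C.
  by rewrite ler_wpM2r// ler_peMr// mulr_ge0// exprn_ge0.
have p3 : 0 <= h * tau ^+ 2 * r * v ^+ 3 * S by rewrite !mulr_ge0 ?exprn_ge0.
have p4 : 0 <= h * tau ^+ 2 * S by rewrite !mulr_ge0 ?exprn_ge0.
have p5 := mulr_ge0 h0 B0; have p6 := mulr_ge0 t0 e0.
have p7 := mulr_ge0 w0 C0.
(* The balance: [tau * e] has weight [-2 + 2/5 + 9/25 + 1 < 0], [h * B] has
   [1/5 + 6 - 96 + 16 + 24 < 0], and [h tau^2 v^2 C] has at most [9 + 12*96 - 48*97 + 12*97 < 0].
   The three noise terms need [27 + 1 <= 36], [3*12*96 = 36*96] and [480*97 <= 6*96*97]. *)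
by lra.
Qed.

Lemma sqr_le_hundredth (R : realFieldType) (x : R) :
  0 <= x -> 10 * x <= 1 -> x ^+ 2 <= 1 / 100.
Proof. by move=> x0 x1; rewrite expr2; nra. Qed.

Section SemiInner.
Variables (R : realFieldType) (V : lmodType R) (E : V -> V -> R).
Hypothesis EC : forall a b, E a b = E b a.
Hypothesis EDl : forall a b c, E (a + b) c = E a c + E b c.
Hypothesis EZl : forall k a b, E (k *: a) b = k * E a b.
Hypothesis E_ge0 : forall a, 0 <= E a a.
Notation sq a := (E a a).

Lemma ENl a b : E (- a) b = - E a b.
Proof. by rewrite -scaleN1r EZl mulN1r. Qed.

Lemma EDr a b c : E c (a + b) = E c a + E c b.
Proof. by rewrite EC EDl !(EC c). Qed.

Lemma EZr k a b : E a (k *: b) = k * E a b.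
Proof. by rewrite EC EZl EC. Qed.

Lemma ENr a b : E a (- b) = - E a b.
Proof. by rewrite EC ENl EC. Qed.

Definition E_bilin := (EDl, EDr, ENl, ENr, EZl, EZr).

Lemma E0l a : E 0 a = 0.
Proof. by rewrite -(scale0r 0) EZl mul0r. Qed.

Lemma E_suml (I : Type) (s : seq I) (P : pred I) (x : I -> V) a :
  E (\sum_(i <- s | P i) x i) a = \sum_(i <- s | P i) E (x i) a.
Proof. by elim/big_rec2: _ => [|i y1 y2 _ <-]; rewrite ?E0l ?EDl. Qed.

Lemma E_sumr (I : Type) (s : seq I) (P : pred I) (x : I -> V) a :
  E a (\sum_(i <- s | P i) x i) = \sum_(i <- s | P i) E a (x i).
Proof. by rewrite EC E_suml; apply: eq_bigr => i _; rewrite EC. Qed.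

Lemma sqN a : sq (- a) = sq a.
Proof. by rewrite !E_bilin opprK. Qed.

Lemma sqZ k a : sq (k *: a) = k ^+ 2 * sq a.
Proof. by rewrite !E_bilin mulrA. Qed.

Lemma sqD a b : sq (a + b) = sq a + 2 * E a b + sq b.
Proof. by rewrite !E_bilin (EC b a); ring. Qed.

Lemma sq_step k a b c : sq (a - k *: b - k *: c) =
  sq a - 2 * k * E a b + k ^+ 2 * sq b + k ^+ 2 * (2 * E b c) + k ^+ 2 * sq c
  - 2 * k * E a c.
Proof. by rewrite !E_bilin (EC b a) (EC c a) (EC c b); ring. Qed.

Lemma sq_young k a b : 0 < k ->
  sq (a + b) <= (1 + k) * sq a + (1 + k^-1) * sq b.
Proof.
move=> k0; have H := mulr_ge0 (ltW k0) (E_ge0 (a - k^-1 *: b)).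
rewrite -subr_ge0; apply: le_trans H _; rewrite !E_bilin (EC b a).
by rewrite le_eqVlt; apply/orP; left; apply/eqP; field; rewrite gt_eqF.
Qed.

Lemma sqD2 a b : sq (a + b) <= 2 * sq a + 2 * sq b.
Proof. by have := @sq_young 1 a b ltr01; rewrite invr1. Qed.

Lemma E_young k a b : 0 < k -> 2 * E a b <= k * sq a + k^-1 * sq b.
Proof. by move=> /(@sq_young _ a b); rewrite !E_bilin (EC b a); lra. Qed.

(** Induction with Young parameter [1 / m], for which [(1 + 1/m) m^2 + (1 + m) = (m + 1)^2]
    exactly. *)
Lemma sq_sum_le m (x : nat -> V) K : (forall i, (i < m)%N -> sq (x i) <= K) ->
  sq (\sum_(0 <= i < m) x i) <= m%:R ^+ 2 * K.
Proof.
elim: m => [|m IH] xK; first by rewrite big_geq// E0l expr0n mul0r.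
rewrite big_nat_recr//=.
have {}IH := IH (fun i im => xK i (ltnW im)).
have Km := xK m (ltnSn m).
have [m0|m0] := posnP m.
  by rewrite m0 big_geq// add0r expr1n mul1r -m0.
have mp : 0 < m%:R :> R by rewrite ltr0n.
have mVp : 0 < m%:R^-1 :> R by rewrite invr_gt0.
apply: le_trans (sq_young _ _ mVp) _; rewrite invrK.
have -> : m.+1%:R ^+ 2 * K =
  (1 + m%:R^-1) * (m%:R ^+ 2 * K) + (1 + m%:R) * K.
  by rewrite -natr1; field; rewrite gt_eqF.
by apply: lerD; rewrite ler_wpM2l// addr_ge0// ltW.
Qed.

Lemma sq_orth_sum_le m (x : nat -> V) K :
  (forall i, (i < m)%N -> sq (x i) <= K) ->
  (forall i j, (i < j < m)%N -> E (x i) (x j) = 0) ->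
  sq (\sum_(0 <= i < m) x i) <= m%:R * K.
Proof.
elim: m => [|m IH] xK xo; first by rewrite big_geq// E0l mul0r.
rewrite big_nat_recr//= EDl !EDr (EC (x m)).
have -> : E (\sum_(0 <= i < m) x i) (x m) = 0.
  rewrite E_suml big_nat big1// => i /= im; apply: xo.
  by rewrite im ltnSn.
rewrite addr0 add0r -natr1 mulrDl mul1r lerD ?xK//.
apply: IH => [i im|i j /andP[ij jm]]; first by rewrite xK// ltnW.
by apply: xo; rewrite ij ltnW.
Qed.

(* The parameter of Young's inequality is min(1, (1 - r) / 2r). *)
Lemma young_contraction r : 0 <= r < 1 -> exists r', [/\ 0 <= r',
  r' <= 1 - (1 - r) / 2, r' <= 2 * r &
  forall a b, r * sq (a + b) <= r' * sq a + 2 * r / (1 - r) * sq b].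
Proof.
move=> /andP[r0 r1]; have q0 : 0 < 1 - r by rewrite subr_gt0.
have [->|rn0] := eqVneq r 0.
  by exists 0; split; [by []|lra|lra|]; move=> a b;
    rewrite !mul0r mulr0 !mul0r add0r.
have rp : 0 < r by rewrite lt_def rn0.
(* [3 r <= 1] is exactly the range where [(1 - r) / 2r >= 1], so that the minimum is 1. *)
have [r3|r3] := lerP (3 * r) 1.
  exists (2 * r); split; [lra|lra|lra|] => a b.
  apply: le_trans (ler_wpM2l r0 (sqD2 a b)) _.
  rewrite mulrDr !mulrA lerD ?(mulrC r)// ler_wpM2r// ler_peMr//; first lra.
  by rewrite invf_ge1//; lra.
have kp : 0 < (1 - r) / (2 * r) by rewrite divr_gt0// mulr_gt0.
exists (1 - (1 - r) / 2); split; [lra|lra|lra|] => a b.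
apply: le_trans (ler_wpM2l r0 (sq_young a b kp)) _.
rewrite mulrDr !mulrA lerD//.
  by rewrite le_eqVlt; apply/orP; left; apply/eqP; field.
rewrite ler_wpM2r//.
have -> : r * (1 + ((1 - r) / (2 * r))^-1) = (1 + r) * r / (1 - r).
  by field; rewrite rn0 gt_eqF.
by rewrite ler_wpM2r ?invr_ge0 ?(ltW q0)// ler_wpM2r//; lra.
Qed.

Variables J Wd : {linear V -> V}.
Hypothesis JK : forall a, J (J a) = J a.
Hypothesis EJ : forall a b, E (J a) b = E a (J b).
Notation Pi a := (a - J a).

Lemma sq_split a : sq a = sq (J a) + sq (Pi a).
Proof.
rewrite !E_bilin (EC (J a) a); have -> : sq (J a) = E a (J a) by rewrite EJ JK.
ring.
Qed.

Lemma sqJ_le a : sq (J a) <= sq a.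
Proof. by rewrite (sq_split a) lerDl. Qed.

Lemma sqPi_le a : sq (Pi a) <= sq a.
Proof. by rewrite (sq_split a) lerDr. Qed.

Lemma PiD a b : Pi (a + b) = Pi a + Pi b.
Proof. by rewrite linearD /= opprD addrACA. Qed.

Lemma E_PiPi a b : E (Pi a) (Pi b) = E (Pi a) b.
Proof. by rewrite !E_bilin -[E (J a) (J b)]EJ JK (EJ a b); ring. Qed.

Lemma sqPi_sub a b : sq (Pi (a - b)) = sq (Pi a) - 2 * E (Pi a) b + E (Pi b) b.
Proof.
have -> : Pi (a - b) = Pi a + - Pi b.
  by rewrite PiD linearN /= opprK opprB [- b + _]addrC.
by rewrite sqD sqN ENr !E_PiPi mulrN.
Qed.

Lemma PiZ k a : Pi (k *: a) = k *: Pi a.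
Proof. by rewrite linearZ /= scalerBr. Qed.

(* Q is the tracking variable at the start of the round without its noise, g l
   and N l are the exact stacked gradient and the noise at the l-th local
   iterate X l, and X d is the iterate before communication. *)
Variables (d : nat) (X g N : nat -> V) (Q : V) (gamma L S : R).
Hypotheses (d_gt0 : (0 < d)%N) (gamma0 : 0 <= gamma) (L0 : 0 <= L)
  (S0 : 0 <= S).
Hypothesis step : 10 * (gamma * d%:R * L) <= 1.
Hypothesis XE : forall i, (i <= d)%N -> X i = X 0%N - gamma *:
  (i%:R *: Q + \sum_(0 <= l < i) (g l - g 0%N) + \sum_(0 <= l < i) N l).
Hypothesis g_lip : forall l, (l < d)%N ->
  sq (g l - g 0%N) <= L ^+ 2 * sq (X l - X 0%N).
Hypothesis N_sq : forall l, (l < d)%N -> sq (N l) <= S.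
Hypothesis N_orth : forall i j, (i < j < d)%N -> E (N i) (N j) = 0.
Notation tau := (gamma * d%:R).
Notation M := (5 / 2 * tau ^+ 2 * (sq Q + S)).

Lemma tau_ge0 : 0 <= tau. Proof. by rewrite mulr_ge0. Qed.

Lemma M_ge0 : 0 <= M.
Proof. by rewrite !mulr_ge0 ?addr_ge0 ?exprn_ge0 ?tau_ge0. Qed.

Lemma noise_sum_le i : (i <= d)%N -> sq (\sum_(0 <= l < i) N l) <= i%:R * S.
Proof.
move=> id; apply: sq_orth_sum_le => [l li|l j /andP[lj ji]].
  by apply: N_sq; exact: leq_trans id.
by apply: N_orth; rewrite lj; exact: leq_trans id.
Qed.

Lemma lip_sum_le i : (i <= d)%N ->
  (forall l, (l < i)%N -> sq (X l - X 0%N) <= M) ->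
  sq (\sum_(0 <= l < i) (g l - g 0%N)) <= i%:R ^+ 2 * (L ^+ 2 * M).
Proof.
move=> id XM; apply: sq_sum_le => l li.
apply: le_trans (g_lip (leq_trans li id)) _.
by rewrite ler_wpM2l ?exprn_ge0// XM.
Qed.

Lemma drift_le i : (i <= d)%N -> sq (X i - X 0%N) <= M.
Proof.
elim/ltn_ind: i => i IH id.
have D1 := lip_sum_le id (fun l li => IH l li (ltnW (leq_trans li id))).
have D2 := noise_sum_le id.
rewrite (XE id) addrAC subrr add0r sqN sqZ.
set a := i%:R *: Q; set b := \sum_(0 <= l < i) _ in D1 *.
set c := \sum_(0 <= l < i) N l in D2 *.
(* Parameter [1/9] gives weights [20/9], [20/9] and [10]. The last one multiplies [M] itself,
   bounded inductively, and contributes [25 (tau L)^2 <= 1/4]; since [20/9 + 1/4 <= 5/2], the bound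
   [M] reproduces itself. *)
have nine0 : 0 < 9^-1 :> R by rewrite invr_gt0.
have H1 := @sq_young 9^-1 (a + c) b nine0; rewrite invrK in H1.
have H2 := sqD2 a c.
have aE : sq a = i%:R ^+ 2 * sq Q by rewrite /a sqZ.
have iR : (i%:R : R) <= d%:R by rewrite ler_nat.
have i0 : 0 <= (i%:R : R) by [].
have d1 : 1 <= (d%:R : R) by rewrite ler1n.
have i2 : (i%:R : R) ^+ 2 <= d%:R ^+ 2 by rewrite ler_pXn2r// nnegrE.
have b1 : sq a <= d%:R ^+ 2 * sq Q by rewrite aE ler_wpM2r.
have b2 : sq c <= d%:R ^+ 2 * S.
  apply: le_trans D2 _; rewrite ler_wpM2r//; apply: le_trans iR _.
  by rewrite expr2 ler_peMl.
have b3 : sq b <= d%:R ^+ 2 * (L ^+ 2 * M).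
  by apply: le_trans D1 _; rewrite ler_wpM2r// mulr_ge0 ?exprn_ge0// M_ge0.
have H : sq (a + b + c) <= 20 / 9 * (d%:R ^+ 2 * sq Q) +
    20 / 9 * (d%:R ^+ 2 * S) + 10 * (d%:R ^+ 2 * (L ^+ 2 * M)).
  rewrite addrAC; apply: le_trans H1 _.
  by clear D1 D2 IH nine0 iR i0 d1 i2; lra.
apply: le_trans (ler_wpM2l (exprn_ge0 2 gamma0) H) _.
have K0 : 0 <= tau ^+ 2 * (sq Q + S).
  by rewrite mulr_ge0 ?exprn_ge0 ?addr_ge0 ?tau_ge0.
have h2 : (tau * L) ^+ 2 <= 1 / 100.
  by apply: sqr_le_hundredth => //; rewrite mulr_ge0 ?tau_ge0.
have := ler_wpM2r K0 h2.
have -> : gamma ^+ 2 * (20 / 9 * (d%:R ^+ 2 * sq Q) + 20 / 9 * (d%:R ^+ 2 * S)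
    + 10 * (d%:R ^+ 2 * (L ^+ 2 * M))) =
  20 / 9 * (tau ^+ 2 * (sq Q + S)) +
  25 * ((tau * L) ^+ 2 * (tau ^+ 2 * (sq Q + S))).
  by field.
have -> : M = 5 / 2 * (tau ^+ 2 * (sq Q + S)) by rewrite -mulrA.
by lra.
Qed.

Lemma lip_sum_round :
  sq (\sum_(0 <= l < d) (g l - g 0%N)) <= d%:R ^+ 2 * (L ^+ 2 * M).
Proof. by apply: lip_sum_le => // l ld; exact: drift_le (ltnW ld). Qed.

Variable r : R.
Hypothesis r01 : 0 <= r < 1.
Hypothesis JW : forall a, J (Wd a) = J a.
Hypothesis W_mix : forall a, sq (Pi (Wd a)) <= r * sq (Pi a).
Hypothesis W_nonexp : forall a, sq (Wd a) <= sq a.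
Hypothesis W_drift : forall a, sq (Wd a - a) <= 4 * sq (Pi a).

Lemma consensus_step : sq (Pi (Wd (X d))) <=
  (1 - (1 - r) / 2) * sq (Pi (X 0%N))
  + 6 * r / (1 - r) * tau ^+ 2 * (sq (Pi Q) + S + L ^+ 2 * M).
Proof.
have /andP[r0 r1] := r01.
apply: le_trans (W_mix _) _; have [r' [_ r'1 _ Y]] := young_contraction r01.
have sumsE := lip_sum_round.
set b := \sum_(0 <= l < d) (g l - g 0%N) in sumsE *.
set c := \sum_(0 <= l < d) N l.
have -> : Pi (X d) = Pi (X 0%N) + - (gamma *: Pi (d%:R *: Q + b + c)).
  by rewrite (XE (leqnn d)) -/b -/c PiD -scaleNr PiZ scaleNr.
apply: le_trans (Y _ _) _; apply: lerD; first by rewrite ler_wpM2r.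
have d1 : 1 <= (d%:R : R) by rewrite ler1n.
have H : sq (Pi (d%:R *: Q + b + c)) <=
    3 * d%:R ^+ 2 * (sq (Pi Q) + S + L ^+ 2 * M).
  (* Parameter [1/2] gives each of the three terms weight 3. Young is applied between [Q] and the
     noise too, because [Q] may contain [N 0]; orthogonality is used only inside the noise sum. *)
  rewrite !PiD; have half0 : 0 < 2^-1 :> R by rewrite invr_gt0.
  have H1 := @sq_young 2^-1 (Pi (d%:R *: Q) + Pi b) (Pi c) half0.
  rewrite invrK in H1.
  have H2 := sqD2 (Pi (d%:R *: Q)) (Pi b).
  rewrite PiZ sqZ in H2; rewrite PiZ in H1.
  have H3 := le_trans (sqPi_le b) sumsE.
  have H4 : sq (Pi c) <= d%:R ^+ 2 * S.
    apply: le_trans (sqPi_le c) _; apply: le_trans (noise_sum_le (leqnn d)) _.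
    by rewrite ler_wpM2r// expr2 ler_peMl.
  by rewrite PiZ; lra.
rewrite sqN sqZ.
apply: (le_trans (ler_wpM2l _ (ler_wpM2l (exprn_ge0 2 gamma0) H))).
  by rewrite divr_ge0 ?mulr_ge0// subr_ge0 ltW.
rewrite le_eqVlt; apply/orP; left; apply/eqP; field.
by rewrite gt_eqF// subr_gt0.
Qed.

Variables (gp Np Y0 : V).
Hypothesis gp_lip : sq (gp - g 0%N) <= L ^+ 2 * sq (Wd (X d) - X 0%N).
Hypothesis Np_sq : sq Np <= S.
Hypothesis Np_orth : E (Pi (Q + (gp - g 0%N))) Np = 0.
Hypothesis Q_le : sq (Pi Q) <= sq (Pi Y0) + 2 * S.

Lemma tracking_step : sq (Pi (Wd (Q + (gp - g 0%N) + Np))) <=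
  (1 - (1 - r) / 2) * sq (Pi Y0)
  + 2 * r / (1 - r) * L ^+ 2 * (5 / 4 * M + 20 * sq (Pi (X 0%N)))
  + 5 * r * S.
Proof.
have /andP[r0 r1] := r01; have q0 : 0 < 1 - r by rewrite subr_gt0.
apply: le_trans (W_mix _) _; have [r' [r'0 r'1 r'2 Y]] := young_contraction r01.
have -> : sq (Pi (Q + (gp - g 0%N) + Np)) =
    sq (Pi (Q + (gp - g 0%N))) + sq (Pi Np).
  rewrite (PiD (Q + (gp - g 0%N)) Np).
  rewrite (sqD (Pi (Q + (gp - g 0%N))) (Pi Np)).
  by rewrite (E_PiPi (Q + (gp - g 0%N)) Np) Np_orth mulr0 addr0.
rewrite mulrDr [Pi (Q + _)]PiD.
(* Communication moves the iterate even without local steps. Parameter [1/4] gives [5/4] on the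
   nonexpansive image of the drift and [5 * 4 = 20] on the consensus error from [W_drift]. *)
have D : sq (Wd (X d) - X 0%N) <= 5 / 4 * M + 20 * sq (Pi (X 0%N)).
  have -> : Wd (X d) - X 0%N = Wd (X d - X 0%N) + (Wd (X 0%N) - X 0%N).
    by rewrite linearB /= addrA subrK.
  have k0 : 0 < 4^-1 :> R by rewrite invr_gt0.
  have := @sq_young 4^-1 (Wd (X d - X 0%N)) (Wd (X 0%N) - X 0%N) k0.
  rewrite invrK.
  have := W_drift (X 0%N); have := le_trans (W_nonexp _) (drift_le (leqnn d)).
  by lra.
have T1 := Y (Pi Q) (Pi (gp - g 0%N)).
have T2 := le_trans (sqPi_le (gp - g 0%N)) gp_lip.
have T3 := ler_wpM2l (exprn_ge0 2 L0) D.
have k0 : 0 <= 2 * r / (1 - r) by rewrite divr_ge0 ?mulr_ge0// ltW.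
have T4 := ler_wpM2l k0 (le_trans T2 T3).
have T5 := ler_wpM2l r0 (le_trans (sqPi_le Np) Np_sq).
have T6 := ler_wpM2l r'0 Q_le.
have T7 := ler_wpM2r (E_ge0 (Pi Y0)) r'1.
(* The variance [2 S] in [Q_le] is multiplied by [r']. Using [r' <= 2 r] here keeps the noise
   proportional to [r]: [4 r S] from this term and [r S] from [Np]. *)
have T8 := ler_wpM2r S0 r'2.
have -> : 2 * r / (1 - r) * L ^+ 2 * (5 / 4 * M + 20 * sq (Pi (X 0%N))) =
  2 * r / (1 - r) * (L ^+ 2 * (5 / 4 * M + 20 * sq (Pi (X 0%N))))
  by rewrite -mulrA.
move: T1 T4 T5 T6 T7 T8.
set u1 := _ * (L ^+ 2 * _); set u2 := r * sq (_ + _);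
  set u3 := _ * sq (Pi (gp - _)).
set u4 := sq (Pi Y0); set u5 := sq (Pi Q).
by lra.
Qed.

Variables (gb Xs : V) (e s : R).
Hypothesis JQ : J Q = J (g 0%N).
Hypothesis gb_lip : forall l, (l < d)%N ->
  sq (g l - gb) <= L ^+ 2 * sq (X l - J (X 0%N)).
Hypothesis gb_sq : sq (J gb) <= 2 * L * e.
Hypothesis JXs : J Xs = Xs.
Hypothesis descent : forall l, (l < d)%N ->
  e - L / 2 * sq (X l - J (X 0%N)) <= E (J (X 0%N) - Xs) (g l).
Hypothesis JN_sq : forall l, (l < d)%N -> sq (J (N l)) <= s.
Hypothesis JN_orth : forall i j, (i < j < d)%N -> E (J (N i)) (J (N j)) = 0.
Hypothesis NX0_orth : forall l, (l < d)%N -> E (J (X 0%N) - Xs) (N l) = 0.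
Hypothesis Ng0_orth : forall l, (l < d)%N -> E (J (g 0%N)) (N l) = 0.
Hypotheses (L_gt0 : 0 < L) (gamma_gt0 : 0 < gamma).

Notation h := (tau * L).
Notation Zd := (5 / 4 * M + 5 * sq (Pi (X 0%N))).

Lemma deviation_le l : (l < d)%N -> sq (X l - J (X 0%N)) <= Zd.
Proof.
move=> ld; have -> : X l - J (X 0%N) = (X l - X 0%N) + Pi (X 0%N).
  by rewrite addrA subrK.
have k0 : 0 < 4^-1 :> R by rewrite invr_gt0.
have := @sq_young 4^-1 (X l - X 0%N) (Pi (X 0%N)) k0; rewrite invrK.
by have := drift_le (ltnW ld); lra.
Qed.

(** The average of [Q] is that of the gradients at the local points. Moving these to the common mean
    costs a consensus error, and at the mean the gradient is controlled by the optimality gap. *)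
Lemma Q_sq_le : sq Q <= sq (Pi Q) + (2 * L ^+ 2 * sq (Pi (X 0%N)) + 4 * L * e).
Proof.
rewrite (sq_split Q) JQ addrC lerD2l.
have -> : J (g 0%N) = J (g 0%N - gb) + J gb by rewrite linearB /= subrK.
apply: le_trans (sqD2 _ _) _.
have := le_trans (sqJ_le _) (gb_lip d_gt0); have := gb_sq; lra.
Qed.

Lemma mean_step : sq (J (X d) - Xs) <= sq (J (X 0%N) - Xs) - 2 * tau * e
  + h * Zd + 4 * h * tau * e + 2 * h ^+ 2 * Zd + h * M
  + gamma ^+ 2 * d%:R * s * h + gamma ^+ 2 * d%:R * s.
Proof.
pose D0 := J (X 0%N) - Xs; pose G := \sum_(0 <= l < d) g l.
pose Ns := \sum_(0 <= l < d) N l.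
have sumB (a : V) : \sum_(0 <= l < d) (g l - a) = G - d%:R *: a.
  by rewrite sumrB sumr_const_nat subn0 scaler_nat.
have d0 : 0 < d%:R :> R by rewrite ltr0n.
have h0 : 0 < h by rewrite !mulr_gt0.
have JXd : J (X d) - Xs = D0 - gamma *: J G - gamma *: J Ns.
  have JS : J (d%:R *: Q + (G - d%:R *: g 0%N) + Ns) = J G + J Ns.
    rewrite !linearD linearN !linearZ /= JQ; congr (_ + _).
    by rewrite scalerN addrC subrK.
  rewrite (XE (leqnn d)) sumB linearB linearZ /= JS scalerDr opprD addrA.
  rewrite (addrAC _ _ (- Xs)); congr (_ + _).
  exact: (addrAC (J (X 0%N)) _ (- Xs)).
have D0N : E D0 (J Ns) = 0.
  rewrite -EJ linearB /= JK JXs -/D0 E_sumr big_nat big1 => // l /=;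
    exact: NX0_orth.
(* Later gradients depend on earlier noise, so [J G] is not orthogonal to [J Ns]. Subtracting [d]
   copies of [g 0], which is orthogonal, leaves only differences controlled by the drift. *)
have GN : E (J G) (J Ns) = E (J (G - d%:R *: g 0%N)) (J Ns).
  rewrite linearB linearZ /= EDl ENl EZl.
  have -> : E (J (g 0%N)) (J Ns) = 0.
    rewrite -EJ JK E_sumr big_nat big1 => // l /=; exact: Ng0_orth.
  by rewrite mulr0 subr0.
have HJN : sq (J Ns) <= d%:R * s.
  rewrite /Ns linear_sum; apply: sq_orth_sum_le => //.
(* Young with parameter [1 / h] balances the two parts: after multiplication by [gamma^2] they
   become [h M] and [h] times the noise of the mean, both of higher order. *)
have HG : 2 * E (J G) (J Ns) <= h^-1 * (d%:R ^+ 2 * (L ^+ 2 * M)) +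
    h * (d%:R * s).
  have hV : 0 < h^-1 by rewrite invr_gt0.
  rewrite GN; apply: le_trans (E_young _ _ hV) _; rewrite invrK.
  apply: lerD; rewrite ler_wpM2l ?invr_ge0 ?(ltW h0)//.
  by apply: le_trans (sqJ_le _) _; rewrite -sumB; exact: lip_sum_round.
have HD : d%:R * e - d%:R * (L / 2 * Zd) <= E D0 G.
  rewrite /G E_sumr.
  have -> : d%:R * e - d%:R * (L / 2 * Zd) = \sum_(0 <= l < d) (e - L / 2 * Zd).
    by rewrite sumr_const_nat subn0 -[RHS]mulr_natl mulrBr.
  rewrite big_nat [leRHS]big_nat; apply: ler_sum => l /= ld.
  apply: le_trans (descent ld); rewrite lerD2l lerN2 ler_wpM2l ?divr_ge0//.
  exact: deviation_le.
have HJG : sq (J G) <= 2 * (d%:R ^+ 2 * (2 * L * e)) + 2 * (d%:R ^+ 2 * (L ^+ 2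
  * Zd)).
  have -> : J G = d%:R *: J gb + J (G - d%:R *: gb).
    by rewrite linearB linearZ /= addrC subrK.
  apply: le_trans (sqD2 _ _) _; rewrite sqZ; apply: lerD; rewrite ler_wpM2l//.
    by rewrite ler_wpM2l ?exprn_ge0.
  apply: le_trans (sqJ_le _) _; rewrite -sumB; apply: sq_sum_le => l ld.
  apply: le_trans (gb_lip ld) _; rewrite ler_wpM2l ?exprn_ge0//.
  exact: deviation_le.
have D0G : E D0 (J G) = E D0 G by rewrite -EJ linearB /= JK JXs.
have -> : sq (J (X d) - Xs) = sq D0 - 2 * gamma * E D0 G + gamma ^+ 2 * sq (J G)
  + gamma ^+ 2 * (2 * E (J G) (J Ns)) + gamma ^+ 2 * sq (J Ns).
  by rewrite JXd sq_step D0N D0G mulr0 subr0.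
have g2 := exprn_ge0 2 gamma0.
have U1 := ler_wpM2l (ltW gamma_gt0) HD.
have U2 := ler_wpM2l g2 HJG.
have U3 := ler_wpM2l g2 HG.
have U4 := ler_wpM2l g2 HJN.
have E3 : gamma ^+ 2 * (h^-1 * (d%:R ^+ 2 * (L ^+ 2 * M)) + h * (d%:R * s)) =
  h * M + gamma ^+ 2 * d%:R * s * h.
  by field; rewrite !gt_eqF.
rewrite E3 in U3; move: U1 U2 U3 U4.
set u0 := sq D0; set u1 := E D0 G; set u2 := sq (J G); set u3 := E (J G) (J Ns).
set u4 := sq (J Ns); set MM := M; set BB := sq (Pi _);
  move: u0 u1 u2 u3 u4 MM BB.
move=> u0 u1 u2 u3 u4 MM BB; set dd : R := d%:R; move: dd => dd.
by lra.
Qed.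

Variables mu m : R.
Hypotheses (e_ge0 : 0 <= e) (s_le : s <= S).
Hypothesis e_sc : mu / 4 * sq (J (X 0%N) - Xs) <= e.
Hypothesis step_r : (153 * h) ^+ 2 * r <= (1 - r) ^+ 4.
Hypotheses (m1 : m <= mu * tau / 4) (m2 : m <= (1 - r) / 8).

Lemma lyapunov_step (Yd := Wd (Q + (gp - g 0%N) + Np)) :
  sq (J (Wd (X d)) - Xs) + 192 * h / (1 - r) * sq (Pi (Wd (X d)))
    + 96 * 97 * tau ^+ 2 * h / (1 - r) ^+ 3 * sq (Pi Yd) <=
  (1 - m) * (sq (J (X 0%N) - Xs) + 192 * h / (1 - r) * sq (Pi (X 0%N))
    + 96 * 97 * tau ^+ 2 * h / (1 - r) ^+ 3 * sq (Pi Y0))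
  + gamma ^+ 2 * d%:R * s + tau ^+ 2 * h / (1 - r) ^+ 3
    * (36 * (1 - r) ^+ 3 + 36 * 96 * (1 - r) * r + 6 * 96 * 97 * r) * S.
Proof.
have /andP[r0 r1] := r01.
have Q1 := Q_sq_le; have HA := mean_step; have HB := consensus_step.
have HC := tracking_step.
have d1 : 1 <= (d%:R : R) by rewrite ler1n.
have g2 := exprn_ge0 2 gamma0.
have h0 : 0 <= h by rewrite mulr_ge0 ?tau_ge0.
apply: (@round_scalar R tau L h mu (1 - r) r m _ _ _ _ _ _ e S M Zd _) => //.
- exact: tau_ge0.
- by rewrite subr_gt0 r1 lerBlDr lerDl.
- by rewrite subKr.
- exact: M_ge0.
- rewrite ler_wpM2l ?mulr_ge0 ?exprn_ge0 ?tau_ge0//.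
  by have := Q_le; have := Q1; lra.
- rewrite JW; apply: le_trans HA _; rewrite lerD2r lerD2l.
  (* In the copy of the noise already multiplied by [h], the sharper [s] may be weakened to [S]; the
     leading copy keeps [s]. *)
  have H : gamma ^+ 2 * d%:R * s <= tau ^+ 2 * S.
    apply: (@le_trans _ _ (gamma ^+ 2 * d%:R * S)).
      by rewrite ler_wpM2l// mulr_ge0.
    rewrite exprMn ler_wpM2r// ler_wpM2l// expr2 ler_peMl//.
  apply: le_trans (ler_wpM2r h0 H) _.
  by rewrite le_eqVlt; apply/orP; left; apply/eqP; ring.
- apply: le_trans HB _; rewrite lerD2l ler_wpM2l.
  + by [].
  + by rewrite !mulr_ge0 ?invr_ge0 ?subr_ge0 ?exprn_ge0 ?tau_ge0 ?(ltW r1).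
  rewrite lerD2r; have := Q_le; lra.
Qed.

End SemiInner.

(** * Stacked gradients *)

Section StackedGradient.
Variables (R : realType) (n p : nat) (n_gt0 : (0 < n)%N).
Variables (f : 'I_n -> 'rV[R]_p -> R) (mu L : R).
Hypotheses (mu_ge0 : 0 <= mu) (L_gt0 : 0 < L).
Hypothesis f_sc : forall i, strongly_convex mu (f i).
Hypothesis f_smooth : forall i, smooth L (f i).
Notation J := (Jmx R n).

Definition grad_mx (A : 'M[R]_(n, p)) : 'M[R]_(n, p) :=
  \matrix_(i, j) grad (f i) (row i A) 0 j.

Lemma row_grad_mx A i : row i (grad_mx A) = grad (f i) (row i A).
Proof. by apply/rowP => j; rewrite !mxE. Qed.

Lemma grad_mx_lip A B : ip (grad_mx A - grad_mx B) (grad_mx A - grad_mx B) <=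
  L ^+ 2 * ip (A - B) (A - B).
Proof.
rewrite ip_row (ip_row (A - B)) mulr_sumr; apply: ler_sum => i _.
rewrite !linearB /= !row_grad_mx -!fnorm_sq -exprMn.
rewrite ler_pXn2r// ?nnegrE ?mulr_ge0 ?fnorm_ge0 ?(ltW L_gt0)//.
exact: (f_smooth i).2.
Qed.

Lemma row_J (A : 'M[R]_(n, p)) i : row i (J *m A) = avg A.
Proof.
rewrite -ones_avg row_mul; apply/rowP => j.
by rewrite mxE big_ord1 !mxE mul1r.
Qed.

Lemma row_ones (z : 'rV[R]_p) i : row i (ones R n *m z) = z.
Proof. by rewrite row_mul; apply/rowP => j; rewrite mxE big_ord1 !mxE mul1r.
  Qed.

Lemma J_ones (z : 'rV[R]_p) : J *m (ones R n *m z) = ones R n *m z.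
Proof.
have H : avg (ones R n *m z) = z.
  rewrite /avg mulmxA.
  have -> : (ones R n)^T *m ones R n = n%:R%:M.
    apply/matrixP => i j; rewrite !ord1 !mxE.
    under eq_bigr do rewrite !mxE mulr1.
    by rewrite sumr_const card_ord.
  by rewrite mul_scalar_mx scalerA mulVf ?scale1r ?n_neq0.
by rewrite -ones_avg H.
Qed.

Lemma ip_ones (z y : 'rV[R]_p) :
  ip (ones R n *m z) (ones R n *m y) = n%:R * ip z y.
Proof.
rewrite ip_row; under eq_bigr do rewrite !row_ones.
by rewrite sumr_const card_ord mulr_natl.
Qed.

Definition gap (y z : 'rV[R]_p) : R := \sum_i (f i z - f i y).

(** For each row, smoothness bounds [f i] at the mean from the point [x] of [B], convexity bounds
    [f i y] below from the same [x], and the difference is linear in [grad (f i) x]. *)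
Lemma gap_descent (A B : 'M[R]_(n, p)) y :
  gap y (avg A) <= ip (J *m A - ones R n *m y) (grad_mx B)
    + L / 2 * ip (B - J *m A) (B - J *m A).
Proof.
rewrite (ip_row (J *m A - _)) (ip_row (B - _)) mulr_sumr -big_split /=.
apply: ler_sum => i _; rewrite !linearB /= row_J row_ones row_grad_mx.
set z := avg A; set x := row i B.
have H1 := smooth_descent x z (ltW L_gt0) (f_smooth i).
have H2 := strongly_convex_grad x y mu_ge0 (f_sc i) (f_smooth i).1.
rewrite -(opprB z x) ipNl ipNr opprK.
have -> : ip (z - y) (grad (f i) x) =
    ip (grad (f i) x) (z - x) - ip (grad (f i) x) (y - x).
  by rewrite -ipBr opprB addrA subrK ipC.
lra.
Qed.

(** Strong convexity at the midpoint, where the gap is still nonnegative: half the gap at [z]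
    dominates [n mu / 8] times the squared distance. *)
Lemma gap_sc y z : (forall x, 0 <= gap y x) ->
  mu / 4 * (n%:R * ip (z - y) (z - y)) <= gap y z.
Proof.
move=> gap0; have half : 0 <= (2^-1 : R) <= 1 by lra.
have H i : f i (2^-1 *: z + (1 - 2^-1) *: y) - f i y <=
    2^-1 * (f i z - f i y) - mu / 8 * ip (z - y) (z - y).
  by have := @f_sc i z y _ half; rewrite -fnorm_sq; set N := fnorm _ ^+ 2; lra.
have := gap0 (2^-1 *: z + (1 - 2^-1) *: y).
have : gap y (2^-1 *: z + (1 - 2^-1) *: y) <=
    2^-1 * gap y z - n%:R * (mu / 8 * ip (z - y) (z - y)).
  rewrite /gap mulr_sumr mulr_natl -[X in _ - _ *+ X]card_ord -sumr_const
    -sumrB.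
  by apply: ler_sum => i _; exact: H.
lra.
Qed.

(** A step [- m / L] common to all nodes, with [m] the averaged gradient, lowers the total gap by at
    least [n |m|^2 / (2 L)], and the gap cannot become negative. *)
Lemma gap_grad (A : 'M[R]_(n, p)) y : (forall x, 0 <= gap y x) ->
  ip (J *m grad_mx (J *m A)) (J *m grad_mx (J *m A)) <= 2 * L * gap y (avg A).
Proof.
move=> gap0; set z := avg A; set m := avg (grad_mx (J *m A)).
have mE : n%:R *: m = \sum_i grad (f i) z.
  rewrite /m /avg scalerA mulfV ?n_neq0// scale1r.
  apply/rowP => j; rewrite mxE summxE; apply: eq_bigr => i _.
  by rewrite !mxE mul1r row_J.
rewrite -ones_avg -/m ip_ones; clearbody m.
have H i : f i (z - L^-1 *: m) - f i y <= (f i z - f i y)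
    - L^-1 * ip (grad (f i) z) m + (2 * L)^-1 * ip m m.
  have := smooth_descent z (z - L^-1 *: m) (ltW L_gt0) (f_smooth i).
  rewrite [_ - z]addrAC subrr add0r !ip_bilin opprK => h.
  have -> : (2 * L)^-1 * ip m m = L / 2 * (L^-1 * (L^-1 * ip m m)).
    by field; rewrite gt_eqF.
  by lra.
have H1 : gap y (z - L^-1 *: m) <= gap y z
    - L^-1 * (n%:R * ip m m) + n%:R * ((2 * L)^-1 * ip m m).
  rewrite -ipZl mE ip_suml mulr_sumr /gap -sumrB.
  rewrite mulr_natl -[X in _ + _ *+ X]card_ord -sumr_const -big_split /=.
  by apply: ler_sum => i _; exact: H.
have := le_trans (gap0 _) H1.
have -> : n%:R * ((2 * L)^-1 * ip m m) = L^-1 * (n%:R * ip m m) / 2.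
  by field; rewrite gt_eqF.
set u := n%:R * ip m m => H2.
have : L^-1 * u <= 2 * gap y z by lra.
by rewrite -ler_pdivlMl ?invr_gt0// invrK mulrCA mulrA.
Qed.

End StackedGradient.

(** * The iterates of FlexGT *)

Section FlexGTClosure.
Variables (R : realType) (n p : nat) (T : Type).
Variables (C : (T -> 'M[R]_(n, p)) -> Prop).
Hypothesis C_cst : forall M, C (fun=> M).
Hypothesis C_lin : forall a A B, C A -> C B -> C (fun w => a *: A w + B w).
Hypothesis C_mul : forall (M : 'M[R]_n) A, C A -> C (fun w => M *m A w).

Lemma closed_add A B : C A -> C B -> C (fun w => A w + B w).
Proof.
move=> CA CB; have := C_lin 1 CA CB; congr C; apply/funext => w.
by rewrite scale1r.
Qed.

Lemma closed_sub A B : C A -> C B -> C (fun w => A w - B w).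
Proof.
move=> CA CB; have := C_lin (- 1) CB CA; congr C; apply/funext => w.
by rewrite scaleN1r addrC.
Qed.

Lemma closed_scale a A : C A -> C (fun w => a *: A w).
Proof.
move=> CA; have := C_lin a CA (C_cst 0); congr C; apply/funext => w.
by rewrite addr0.
Qed.

Lemma closed_sum m (A : nat -> T -> 'M[R]_(n, p)) :
  (forall j, (j < m)%N -> C (A j)) -> C (fun w => \sum_(0 <= j < m) A j w).
Proof.
elim: m => [|m IH] CA.
  by have := C_cst 0; congr C; apply/funext => w; rewrite big_geq.
have := closed_add (IH (fun j jm => CA j (ltnW jm))) (CA m (ltnSn m)).
by congr C; apply/funext => w; rewrite big_nat_recr.
Qed.

Variables (W : 'M[R]_n) (d1 d2 : nat) (gamma : R).
Variables (G : T -> nat -> 'M[R]_(n, p) -> 'M[R]_(n, p)) (x0 : 'M[R]_(n, p)).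
Variables (X Y : nat -> T -> 'M[R]_(n, p)) (t0 : nat).
Hypothesis d2_gt0 : (0 < d2)%N.
Hypothesis XY : forall w, flexGT W d1 d2 gamma (G w) x0 (X ^~ w) (Y ^~ w).
Hypothesis C_G : forall t, (t < t0)%N -> C (X t) -> C (fun w => G w t (X t w)).

(** One induction serves measurability, adaptedness and square integrability. The horizon is
    asymmetric because [Y t] uses the samples of time [t], while [X t] only uses earlier ones. *)
Lemma flexGT_closed t : ((t <= t0)%N -> C (X t)) /\ ((t < t0)%N -> C (Y t)).
Proof.
elim/ltn_ind: t => t IH.
have CX s : (s < t)%N -> (s <= t0)%N -> C (X s) by move=> /IH[].
have CY s : (s < t)%N -> (s < t0)%N -> C (Y s) by move=> /IH[].
have [t0E|tp] := posnP t.
  have XE : X t = fun=> x0.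
    by rewrite t0E; apply/funext => w; exact: (flexGT_X0 (XY w)).
  have CXt : C (X t) by rewrite XE.
  split => // tt0; have := C_G tt0 CXt; congr C; apply/funext => w.
  by rewrite t0E; exact/esym/(flexGT_Y0 (XY w)).
(* A positive time is either the end of a round or a local step strictly inside one; each case has
   its own recursion. *)
have : exists k, ((d2 * k < t)%N /\ t = (d2 * k.+1)%N) \/
   (exists l, (1 <= l <= d2 - 1)%N /\ t = (d2 * k + l)%N).
  have := divn_eq t d2; have := ltn_pmod t d2_gt0.
  case: (t %% d2)%N => [|l] ld tE.
    have : (0 < t %/ d2)%N.
      by move: tp; rewrite {1}tE addn0; case: (t %/ d2)%N.
    case: (t %/ d2)%N tE => // k tE _; exists k; left.
    rewrite tE addn0 [(k.+1 * d2)%N]mulnC; split=> //.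
    by rewrite ltn_pmul2l.
  exists (t %/ d2)%N; right; exists l.+1; split; last by rewrite mulnC.
  by rewrite /=; lia.
case=> k [[kt tE]|[l [ld tE]]].
  have ltj j : (j < d2)%N -> (d2 * k + j < t)%N.
    by move=> jd; rewrite tE mulnS addnC ltn_add2r.
  have CXt : (t <= t0)%N -> C (X t).
    move=> tt0.
    have Ck : C (fun w => W ^+ d1 *m (X (d2 * k)%N w -
        gamma *: \sum_(0 <= j < d2) Y (d2 * k + j)%N w)).
      apply: C_mul; apply: closed_sub.
        by apply: CX => //; apply: leq_trans tt0; exact: ltnW.
      apply: closed_scale; apply: closed_sum => j jd.
      by apply: CY; [exact: ltj | exact: leq_trans (ltj _ jd) tt0].
    move: Ck; congr C; apply/funext => w.
    by rewrite tE; exact/esym/(flexGT_Xcomm (XY w)).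
  split => // tt0.
  have kt0 := ltn_trans kt tt0.
  have Ck : C (fun w => W ^+ d1 *m (Y (d2 * k)%N w + G w t (X t w)
                    - G w (d2 * k)%N (X (d2 * k)%N w))).
    apply: C_mul; apply: closed_sub; last first.
      by apply: C_G => //; apply: CX => //; exact: ltnW.
    by apply: closed_add; [exact: CY | apply: C_G => //; apply: CXt;
      exact: ltnW].
  move: Ck; congr C; apply/funext => w.
  by rewrite tE; exact/esym/(flexGT_Ycomm (XY w)).
have kt : (d2 * k < t)%N by rewrite tE; lia.
have CXt : (t <= t0)%N -> C (X t).
  move=> tt0.
  have Ck : C (fun w => X (d2 * k)%N w -
      gamma *: \sum_(0 <= j < l) Y (d2 * k + j)%N w).
    apply: closed_sub; first by apply: CX => //; apply: leq_trans tt0;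
      exact: ltnW.
    apply: closed_scale; apply: closed_sum => j jl.
    have jt : (d2 * k + j < t)%N by rewrite tE ltn_add2l.
    by apply: CY => //; exact: leq_trans jt tt0.
  move: Ck; congr C; apply/funext => w.
  by rewrite tE; exact/esym/(flexGT_Xlocal (XY w)).
split => // tt0.
have kt0 := ltn_trans kt tt0.
have Ck : C (fun w => Y (d2 * k)%N w + G w t (X t w)
                    - G w (d2 * k)%N (X (d2 * k)%N w)).
  apply: closed_sub; last first.
    by apply: C_G => //; apply: CX => //; exact: ltnW.
  by apply: closed_add; [exact: CY | apply: C_G => //; apply: CXt; exact: ltnW].
move: Ck; congr C; apply/funext => w.
by rewrite tE; exact/esym/(flexGT_Ylocal (XY w)).
Qed.

End FlexGTClosure.

(** * Entrywise measurability of random matrices and of sampled gradients *)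

Section MeasurableEntries.
Variables (R : realType) (dT : measure_display) (T : measurableType dT)
  (n p : nat).

Definition mx_measurable (A : T -> 'M[R]_(n, p)) : Prop :=
  forall i j, measurable_fun setT (fun w => A w i j).

Lemma mx_measurable_cst M : mx_measurable (fun=> M).
Proof. by []. Qed.

Lemma mx_measurable_lin a A B : mx_measurable A -> mx_measurable B ->
  mx_measurable (fun w => a *: A w + B w).
Proof.
move=> mA mB i j; under eq_fun do rewrite !mxE.
by apply: measurable_funD => //; exact: measurable_funM.
Qed.

Lemma mx_measurable_mul (M : 'M[R]_n) A : mx_measurable A ->
  mx_measurable (fun w => M *m A w).
Proof.
move=> mA i j; under eq_fun do rewrite mxE; apply: measurable_sum => k.
exact: measurable_funM.
Qed.

Lemma mx_measurable_row A i : mx_measurable A ->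
  forall j, measurable_fun setT (fun w => row i (A w) 0 j).
Proof. by move=> mA j; under eq_fun do rewrite mxE; exact: mA. Qed.

Lemma mx_measurable_grad_mx (f : 'I_n -> 'rV[R]_p -> R) A :
  (forall i, differentiable_everywhere (f i)) -> mx_measurable A ->
  mx_measurable (fun w => grad_mx f (A w)).
Proof.
move=> df mA i j; under eq_fun do rewrite mxE.
by apply: (measurable_grad j (mx_measurable_row i mA) (h := fun z _ => f i z)).
Qed.

Variables (d : 'I_n -> measure_display) (Xi : forall i, measurableType (d i)).
Variables (D : forall i, probability (Xi i) R).
Variable F : forall i, 'rV[R]_p -> Xi i -> R.
Hypothesis F_int : forall i x, (D i).-integrable setT (EFin \o @F i x).
Hypothesis F_diff : forall i s, differentiable_everywhere (fun x => @F i x s).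

Lemma measurable_F i x : measurable_fun setT (@F i x).
Proof. by apply/measurable_EFinP; have /integrableP[] := F_int i x. Qed.

Lemma measurable_sample_grad i (x : T -> 'rV[R]_p) (s : T -> Xi i) j :
  (forall k, measurable_fun setT (fun w => x w 0 k)) -> measurable_fun setT s ->
  measurable_fun setT (fun w => sample_grad F (x w) (s w) 0 j).
Proof.
move=> mx ms;
apply: (measurable_grad j mx (h := fun z w => F z (s w))) => [z|w].
  by apply: measurableT_comp ms; exact: measurable_F.
exact: F_diff.
Qed.

Lemma mx_measurable_stacked_grad (s : T -> forall i, Xi i) A :
  (forall i, measurable_fun setT (s ^~ i)) -> mx_measurable A ->
  mx_measurable (fun w => stacked_grad F (s w) (A w)).
Proof.
move=> ms mA i j; under eq_fun do rewrite mxE.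
exact: (measurable_sample_grad _ (mx_measurable_row i mA) (ms i)).
Qed.

End MeasurableEntries.

Lemma Rintegral_sum (R : realType) (dO : measure_display)
    (Omega : measurableType dO) (P : probability Omega R) (I : Type) (r : seq I)
    (f : I -> Omega -> R) :
  (forall i, P.-integrable setT (EFin \o f i)) ->
  (\int[P]_w (\sum_(i <- r) f i w) = \sum_(i <- r) \int[P]_w f i w)%R.
Proof.
move=> fi; elim: r => [|i r IH].
  by rewrite big_nil; under eq_Rintegral do rewrite big_nil;
    rewrite Rintegral_cst// mul0r.
rewrite big_cons -IH -RintegralD//; first by apply: eq_Rintegral => w _;
  rewrite big_cons.
have := integrable_sum measurableT r (P := xpredT) (fun i _ => fi i).
by apply: eq_integrable => // w _ /=; rewrite sumEFin.
Qed.

(** * Gradient noise along the trajectory: integrability, orthogonality and variance *)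

Section Noise.
Variables (R : realType) (n p : nat).
Variables (dO : measure_display) (Omega : measurableType dO)
  (P : probability Omega R).
Variables (d : 'I_n -> measure_display) (Xi : forall i, measurableType (d i)).
Variables (D : forall i, probability (Xi i) R).
Variable xi : forall i : 'I_n, nat -> {RV P >-> Xi i}.
Variable F : forall i, 'rV[R]_p -> Xi i -> R.
Variables (L sigma : R).
Hypotheses (L_gt0 : 0 < L) (sigma_ge0 : 0 <= sigma).
Hypothesis F_int : forall i x, (D i).-integrable setT (EFin \o @F i x).
Hypothesis F_diff : forall i s, differentiable_everywhere (fun x => @F i x s).
Hypothesis f_smooth : forall i, smooth L (local_cost F D i).
Hypothesis F_unbiased : unbiased F D.
Hypothesis F_variance : variance_le F D sigma.
Hypothesis xi_law : forall i t (A : set (Xi i)), measurable A ->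
  distribution P (xi i t) A = D i A.
Hypothesis xi_indep : mutually_independent (fun it : 'I_n * nat =>
  xi it.1 it.2).
Variables (W : 'M[R]_n) (d1 d2 : nat) (d2_gt0 : (0 < d2)%N) (gamma : R).
Variables (x0 : 'M[R]_(n, p)) (X Y : nat -> Omega -> 'M[R]_(n, p)).
Hypothesis XY : forall w, flexGT W d1 d2 gamma
  (fun t => stacked_grad F (fun i => xi i t w)) x0 (X ^~ w) (Y ^~ w).

Notation fl := (local_cost F D).
Notation other i t :=
  (g_sigma_algebraType (others (fun it : 'I_n * nat => xi it.1 it.2) (i, t))).

(* Weaker than predictability: for each node [i] only the sample [xi i t] is
   excluded, later samples are not. *)
Definition adapted t (A : Omega -> 'M[R]_(n, p)) : Prop :=
  forall i, mx_measurable (A : other i t -> 'M[R]_(n, p)).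

Definition noise t (w : Omega) : 'M[R]_(n, p) :=
  stacked_grad F (fun i => xi i t w) (X t w) - grad_mx fl (X t w).

Lemma fl_diff i : differentiable_everywhere (fl i).
Proof. exact: (f_smooth i).1. Qed.

Lemma measurable_xi_other i t j s : (j, s) != (i, t) ->
  measurable_fun setT (xi j s : other i t -> Xi j).
Proof. by move=> /(@measurable_others _ _ _ _ _ _ _ (fun it : 'I_n * nat =>
  xi it.1 it.2)). Qed.

Lemma iterates_adapted i t s :
  ((s <= t)%N -> mx_measurable (X s : other i t -> 'M[R]_(n, p))) /\
  ((s < t)%N -> mx_measurable (Y s : other i t -> 'M[R]_(n, p))).
Proof.
apply: (@flexGT_closed R n p (other i t)
  (@mx_measurable R _ (other i t) n p) (@mx_measurable_cst _ _ _ _ _)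
  (@mx_measurable_lin _ _ _ _ _) (@mx_measurable_mul _ _ _ _ _) W d1 d2 gamma
  (fun w t => stacked_grad F (fun i => xi i t w)) x0 X Y t d2_gt0 XY _ s).
move=> s' s't mX.
apply: (mx_measurable_stacked_grad F_int F_diff (s := fun (w : other i t) j =>
  xi j s' w)) => // j.
by apply: measurable_xi_other; rewrite xpair_eqE negb_and (ltn_eqF s't) orbT.
Qed.

Lemma adapted_mul t (M : 'M[R]_n) A : adapted t A ->
  adapted t (fun w => M *m A w).
Proof. by move=> aA i; exact: mx_measurable_mul. Qed.

Lemma adapted_X t s : (s <= t)%N -> adapted t (X s).
Proof. by move=> st i; apply: (iterates_adapted i t s).1. Qed.

Lemma adapted_Y t s : (s < t)%N -> adapted t (Y s).
Proof. by move=> st i; apply: (iterates_adapted i t s).2. Qed.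

Lemma adapted_grad t A : adapted t A -> adapted t (fun w => grad_mx fl (A w)).
Proof. by move=> aA i; apply: mx_measurable_grad_mx => //; exact: fl_diff. Qed.

(** The case [s = t], [k != i] is included: the noise of another node at the same time is known
    without [xi i t], which makes the rows uncorrelated. *)
Lemma noise_row_measurable i t s k : (s <= t)%N -> (k, s) != (i, t) ->
  forall j, measurable_fun setT ((fun w => noise s w k j) : other i t -> R).
Proof.
move=> st ks j.
apply: (eq_measurable_fun (fun w : other i t =>
  sample_grad F (row k (X s w)) (xi k s w) 0 j - grad_mx fl (X s w) k j)).
  by move=> w _; rewrite /noise !mxE.
apply: measurable_funB.
  apply: (measurable_sample_grad F_int F_diff); last exact: measurable_xi_other.
  by apply: mx_measurable_row; exact: adapted_X.
exact: (mx_measurable_grad_mx fl_diff (@adapted_X t s st i) k j).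
Qed.

Lemma adapted_noise t s : (s < t)%N -> adapted t (noise s).
Proof.
move=> st i k j; apply: noise_row_measurable; first exact: ltnW.
by rewrite xpair_eqE negb_and (ltn_eqF st) orbT.
Qed.

Lemma measurable_noise t : mx_measurable (noise t).
Proof.
move=> i j.
apply: (eq_measurable_fun (fun w : Omega =>
  sample_grad F (row i (X t w)) (xi i t w) 0 j - grad_mx fl (X t w) i j)).
  by move=> w _; rewrite /noise !mxE.
have mX : mx_measurable (X t).
  apply: (@flexGT_closed R n p Omega
    (@mx_measurable R _ Omega n p) (@mx_measurable_cst _ _ _ _ _)
    (@mx_measurable_lin _ _ _ _ _) (@mx_measurable_mul _ _ _ _ _) W d1 d2 gamma
    (fun w t => stacked_grad F (fun i => xi i t w)) x0 X Y t d2_gt0 XY _ t).1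
      => //.
  by move=> s st; apply: (mx_measurable_stacked_grad F_int F_diff
      (s := fun w j => xi j s w)).
apply: measurable_funB.
  by apply: (measurable_sample_grad F_int F_diff) => //;
    exact: mx_measurable_row.
exact: (mx_measurable_grad_mx fl_diff mX i j).
Qed.

Section OneNode.
Variables (i : 'I_n).
Notation dev x s j := (sample_grad F x s 0 j - grad (fl i) x 0 j).

Lemma measurable_dev (dT : measure_display) (T : measurableType dT)
    (x : T -> 'rV[R]_p) (s : T -> Xi i) j :
  (forall k, measurable_fun setT (fun w => x w 0 k)) -> measurable_fun setT s ->
  measurable_fun setT (fun w => dev (x w) (s w) j).
Proof.
move=> mx ms; apply: measurable_funB; first exact: (measurable_sample_grad
  F_int F_diff).
by apply: (measurable_grad j mx (h := fun z _ => fl i z)) => // w;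
  exact: fl_diff.
Qed.

Lemma fnorm_dev x (s : Xi i) :
  fnorm (sample_grad F x s - grad (fl i) x) ^+ 2 = \sum_j dev x s j ^+ 2.
Proof.
by rewrite fnorm_sq /ip big_ord1; apply: eq_bigr => j _; rewrite !mxE expr2.
Qed.

Lemma measurable_dev_sq (dT : measure_display) (T : measurableType dT)
    (x : T -> 'rV[R]_p) (s : T -> Xi i) :
  (forall k, measurable_fun setT (fun w => x w 0 k)) -> measurable_fun setT s ->
  measurable_fun setT (fun w => fnorm (sample_grad F (x w) (s w) - grad (fl i)
    (x w)) ^+ 2).
Proof.
move=> mx ms; under eq_fun do rewrite fnorm_dev.
by apply: measurable_sum => j; apply: measurable_funX; exact: measurable_dev.
Qed.

Lemma dev_integrable x j :
  (D i).-integrable setT (fun s => (dev x s j)%:E).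
Proof.
have md : measurable_fun setT (fun s : Xi i => dev x s j).
  by apply: (measurable_dev (x := fun=> x) (s := id)).
apply: integrable_sq => //; apply/integrableP; split.
  by apply/measurable_EFinP; exact: measurable_funX.
have := F_variance i x; rewrite unlock => /le_lt_trans -/(_ _ (ltry _)).
apply: le_lt_trans; apply: ge0_le_integral => //.
- by apply/measurable_EFinP; apply: measurableT_comp => //;
  exact: measurable_funX.
- apply/measurable_EFinP.
  by apply: (measurable_dev_sq (x := fun=> x) (s := id)).
move=> s _; rewrite /= lee_fin ger0_norm ?sqr_ge0// fnorm_dev
  (bigD1 j)//= lerDl.
by apply: sumr_ge0 => k _; exact: sqr_ge0.
Qed.

Lemma dev_mean x j : (\int[D i]_s (dev x s j)%:E = 0)%E.
Proof.
have iD := dev_integrable x j; set c := grad (fl i) x 0 j in iD *.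
have ic : (D i).-integrable setT (EFin \o (fun _ : Xi i => c)).
  exact: finite_measure_integrable_cst.
(* The variance bound makes the deviation integrable; adding the constant mean back shows that the
   sampled gradient is integrable, so the expectation may be split. *)
have iS : (D i).-integrable setT (EFin \o (fun s : Xi i =>
  sample_grad F x s 0 j)).
  have := integrableD measurableT iD ic.
  by apply: eq_integrable => // s _; rewrite /= -EFinD subrK.
have := F_unbiased i x j; rewrite unlock => SE.
have := expectation_cst (D i) c; rewrite unlock => CE.
by rewrite (integralB_EFin measurableT iS ic) SE CE subee.
Qed.

(** The variance is bounded at deterministic points only. Freezing makes [X t] deterministic inside
    the inner integral, since it does not depend on [xi i t]. *)
Lemma noise_row_sq t :
  (\int[P]_w (ip (row i (noise t w)) (row i (noise t w)))%:E <=
    (sigma ^+ 2)%:E)%E.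
Proof.
pose H (x : other i t * Xi i) : \bar R :=
  (fnorm (sample_grad F (row i (X t x.1)) x.2 - grad (fl i)
    (row i (X t x.1))) ^+ 2)%:E.
have mH : measurable_fun setT H.
  apply/measurable_EFinP.
  apply: (measurable_dev_sq (x := fun x : other i t * Xi i =>
    row i (X t x.1))) => // k.
  apply: (measurableT_comp (f := fun w : other i t => row i (X t w) 0 k)) => //.
  by apply: mx_measurable_row; exact: adapted_X.
have := @ge0_integral_freeze _ _ _ P _ _ _ (fun it : 'I_n * nat => xi it.1 it.2)
  xi_indep (i, t) (D i) (@xi_law i t) H mH.
move=> HE.
rewrite [leLHS](_ : _ = (\int[P]_w H (w, xi i t w))%E); last first.
  apply: eq_integral => w _; rewrite /H fnorm_sq /= /noise; congr (ip _ _)%:E;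
  by apply/rowP => j; rewrite !mxE.
rewrite HE; last by move=> x; rewrite lee_fin sqr_ge0.
apply: (@le_trans _ _ (\int[P]_w (cst (sigma ^+ 2)%:E w))%E).
  apply: ge0_le_integral => //.
  - by move=> w _; apply: integral_ge0 => s _; rewrite lee_fin sqr_ge0.
  - apply: (measurableT_comp (f := fun w : other i t =>
    (\int[D i]_s H (w, s))%E)).
      apply: measurable_fun_fubini_tonelli_F => //.
      by move=> x; rewrite lee_fin sqr_ge0.
    exact: measurable_id_others.
  - by move=> w _; have := F_variance i (row i (X t w)); rewrite unlock.
by have := expectation_cst P (sigma ^+ 2); rewrite unlock => ->.
Qed.

(** With the other samples frozen, [Z] is a constant factor and the deviation has mean zero by
    unbiasedness. *)
Lemma row_orth t (Z : Omega -> R) j :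
  measurable_fun setT (Z : other i t -> R) ->
  P.-integrable setT (fun w => (Z w ^+ 2)%:E) ->
  P.-integrable setT (fun w => (noise t w i j ^+ 2)%:E) ->
  (\int[P]_w (Z w * noise t w i j))%R = 0.
Proof.
move=> mZ iZ iN.
pose H (x : other i t * Xi i) : \bar R :=
  (Z x.1 * dev (row i (X t x.1)) x.2 j)%:E.
have NE w : noise t w i j = dev (row i (X t w)) (xi i t w) j.
  by rewrite /noise !mxE.
have mH : measurable_fun setT H.
  apply/measurable_EFinP; apply: measurable_funM.
    exact: (measurableT_comp mZ).
  apply: (measurable_dev j (x := fun x : other i t * Xi i =>
    row i (X t x.1))) => // k.
  apply: (measurableT_comp (f := fun w : other i t => row i (X t w) 0 k)) => //.
  by apply: mx_measurable_row; exact: adapted_X.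
have mZO : measurable_fun setT (Z : Omega -> R).
  exact: (measurableT_comp mZ (@measurable_id_others _ _ _ P _ _ _
    (fun it : 'I_n * nat => xi it.1 it.2) (i, t))).
have HE := @integral_freeze _ _ _ P _ _ _ (fun it : 'I_n * nat => xi it.1 it.2)
  xi_indep (i, t) (D i) (@xi_law i t) H mH.
rewrite /Rintegral (_ : \int[P]_w _ = \int[P]_w H (w, xi i t w))%E; last first.
  by apply: eq_integral => w _; rewrite /H /= NE.
rewrite HE; last first.
  have := integrable_mul_sq mZO (measurable_noise t i j) iZ iN.
  by apply: eq_integrable => // w _; rewrite /H /= NE.
rewrite integral0_eq// => w _; rewrite /H /=.
under eq_integral do rewrite EFinM.
by rewrite integralZl ?dev_mean ?mule0//; exact: dev_integrable.
Qed.

End OneNode.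

Lemma measurable_noise_row_sq t i :
  measurable_fun setT (fun w => ip (row i (noise t w)) (row i (noise t w))).
Proof.
apply: (eq_measurable_fun (fun w => \sum_j noise t w i j ^+ 2)).
  by move=> w _; rewrite /ip big_ord1; apply: eq_bigr => j _;
    rewrite !mxE expr2.
by apply: measurable_sum => j; apply: measurable_funX; exact: measurable_noise.
Qed.

Lemma integrable_noise_row_sq t i :
  P.-integrable setT (fun w => (ip (row i (noise t w)) (row i (noise t w)))%:E).
Proof.
apply/integrableP; split.
  by apply/measurable_EFinP; exact: measurable_noise_row_sq.
under eq_integral => w _ do rewrite gee0_abs ?lee_fin ?ip_ge0//.
exact: le_lt_trans (noise_row_sq i t) (ltry _).
Qed.

Lemma noise_sqint t : sqint P (noise t).
Proof.
apply: (@sqint_le _ _ _ P _ _ _ (fun w => ip (noise t w) (noise t w))) => //.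
  exact: measurable_noise.
have := integrable_sum measurableT (index_enum _) (P := xpredT)
  (fun i _ => integrable_noise_row_sq t i).
by apply: eq_integrable => // w _; rewrite sumEFin /= -ip_row.
Qed.

Lemma grad_sqint A : sqint P A -> sqint P (fun w => grad_mx fl (A w)).
Proof.
move=> sA; have mA : mx_measurable A by move=> i j; have [] := sA i j.
pose B := grad_mx fl 0.
apply: (@sqint_le _ _ _ P _ _ _ (fun w => 2 * L ^+ 2 * ip (A w)
  (A w) + 2 * ip B B)).
- by apply: mx_measurable_grad_mx => //; exact: fl_diff.
- have := integrableD measurableT
    (integrableZl measurableT (2 * L ^+ 2) (integrable_ip sA sA))
    (finite_measure_integrable_cst P (2 * ip B B) measurableT).
  by apply: eq_integrable => // w _; rewrite /= EFinD EFinM.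
move=> w; have H := @ip_young _ _ _ 1 (grad_mx fl (A w) - B) B ltr01.
rewrite subrK invr1 in H; apply: le_trans H _.
have := grad_mx_lip L_gt0 f_smooth (A w) 0; rewrite subr0 -/B; lra.
Qed.

(** The stacked gradient is the exact one, of linear growth, plus a noise whose second moment is
    bounded unconditionally, so the induction closes. *)
Lemma iterates_sqint t : sqint P (X t) /\ sqint P (Y t).
Proof.
have sG s : (s < t.+1)%N -> sqint P (X s) ->
    sqint P (fun w => stacked_grad F (fun i => xi i s w) (X s w)).
  move=> _ sX; have := sqint_lin 1 (grad_sqint sX) (noise_sqint s).
  by congr (sqint P _); apply/funext => w; rewrite scale1r addrC subrK.
have [H1 H2] := @flexGT_closed R n p Omega
  (@sqint _ _ _ P n p) (@sqint_cst _ _ _ P _ _)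
  (@sqint_lin _ _ _ P _ _) (@sqint_mul _ _ _ P _ _) W d1 d2 gamma
  (fun w t => stacked_grad F (fun i => xi i t w)) x0 X Y t.+1 d2_gt0 XY
  sG t.
by split; [exact: H1 | exact: H2].
Qed.

Definition XL t : L2 P n p := mkL2 (iterates_sqint t).1.
Definition YL t : L2 P n p := mkL2 (iterates_sqint t).2.
Definition NL t : L2 P n p := mkL2 (noise_sqint t).
Definition gradL (A : L2 P n p) : L2 P n p := mkL2 (grad_sqint (L2_sqint A)).

Lemma integrable_entry (A B : L2 P n p) i j k l :
  P.-integrable setT (fun w => (A w i j * B w k l)%:E).
Proof.
have [[mA iA] [mB iB]] := (L2_sqint A i j, L2_sqint B k l).
exact: integrable_mul_sq.
Qed.

Lemma Eip_entries (A B : L2 P n p) :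
  Eip A B = \sum_i \sum_j (\int[P]_w (A w i j * B w i j))%R.
Proof.
rewrite /Eip /ip Rintegral_sum => [|i].
  by apply: eq_bigr => i _; rewrite Rintegral_sum// => j;
    exact: integrable_entry.
have := integrable_sum measurableT (index_enum _) (P := xpredT)
  (fun j _ => integrable_entry A B i j i j).
by apply: eq_integrable => // w _; rewrite sumEFin.
Qed.

Lemma Eip_noise0 t (A : L2 P n p) : adapted t A -> Eip A (NL t) = 0.
Proof.
move=> aA; rewrite Eip_entries big1// => i _; rewrite big1// => j _.
have [_ iA] := L2_sqint A i j; have [_ iN] := noise_sqint t i j.
by apply: row_orth => //; exact: aA.
Qed.

Definition nvar t i : R := \sum_j (\int[P]_w (noise t w i j * noise t w i j))%R.

Lemma nvar_ge0 t i : 0 <= nvar t i.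
Proof.
by apply: sumr_ge0 => j _; apply: Rintegral_ge0 => w _; rewrite -expr2 sqr_ge0.
Qed.

Lemma nvar_le t i : nvar t i <= sigma ^+ 2.
Proof.
rewrite /nvar -Rintegral_sum => [|j]; last exact: (integrable_entry (NL t)
  (NL t)).
rewrite -lee_fin; apply: le_trans (noise_row_sq i t).
rewrite /Rintegral fineK.
  rewrite le_eqVlt; apply/orP; left; apply/eqP; apply: eq_integral => w _.
  by rewrite /ip big_ord1; congr EFin; apply: eq_bigr => j _; rewrite !mxE.
apply: integrable_fin_num => //.
have := integrable_noise_row_sq t i; apply: eq_integrable => // w _.
by rewrite /ip big_ord1; congr EFin; apply: eq_bigr => j _; rewrite !mxE.
Qed.

(** Rows of different nodes are uncorrelated, so only the diagonal of [M] survives. *)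
Lemma Eip_mul_noise t (M : 'M[R]_n) :
  Eip (lmulL2 M (NL t)) (NL t) = \sum_i M i i * nvar t i.
Proof.
rewrite Eip_entries; apply: eq_bigr => i _; rewrite /nvar mulr_sumr.
apply: eq_bigr => j _.
transitivity (\int[P]_w (\sum_k M i k * (noise t w k j * noise t w i j)))%R.
  apply: eq_Rintegral => w _; rewrite /= mxE mulr_suml.
  by apply: eq_bigr => k _; rewrite mulrA.
have iN k : P.-integrable setT (fun w => (noise t w k j * noise t w i j)%:E).
  exact: (integrable_entry (NL t) (NL t)).
rewrite Rintegral_sum => [|k]; last exact: (integrableZl measurableT (M i k)
  (iN k)).
rewrite (bigD1 i)//= big1 ?addr0 => [|k ki]; first exact: (RintegralZl (M i i)
  measurableT (iN i)).
rewrite (RintegralZl (M i k) measurableT (iN k)).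
have [_ i1] := noise_sqint t k j; have [_ i2] := noise_sqint t i j.
rewrite row_orth ?mulr0//; apply: noise_row_measurable => //.
by rewrite xpair_eqE negb_and ki.
Qed.

Notation JL := (lmulL2 (Jmx R n)).
Notation PiL A := (A - JL A).

Lemma lmulL2_comp (M1 M2 : 'M[R]_n) (A : L2 P n p) :
  lmulL2 M1 (lmulL2 M2 A) = lmulL2 (M1 *m M2) A.
Proof. by apply: L2P => w; rewrite /= mulmxA. Qed.

Lemma lmulL2_1 (A : L2 P n p) : lmulL2 1%:M A = A.
Proof. by apply: L2P => w; rewrite /= mul1mx. Qed.

Lemma EipJ (A B : L2 P n p) : Eip (JL A) B = Eip A (JL B).
Proof. by apply: eq_Rintegral => w _; exact: ip_Jl. Qed.

Lemma noise_sq_le t : Eip (NL t) (NL t) <= n%:R * sigma ^+ 2.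
Proof.
have := Eip_mul_noise t 1%:M; rewrite lmulL2_1 => ->.
rewrite mulr_natl -[X in _ *+ X]card_ord -sumr_const; apply: ler_sum => i _.
by rewrite mxE eqxx mul1r nvar_le.
Qed.

Hypothesis n_gt0 : (0 < n)%N.

Lemma JLK (A : L2 P n p) : JL (JL A) = JL A.
Proof. by rewrite lmulL2_comp JmxK. Qed.

(** The diagonal of [J] is [1 / n], which averages the node variances instead of summing them. This
    gain over [noise_sq_le] is the source of sigma^2 / n. *)
Lemma noise_J_sq_le t : Eip (JL (NL t)) (JL (NL t)) <= sigma ^+ 2.
Proof.
rewrite -EipJ JLK Eip_mul_noise.
have -> : sigma ^+ 2 = \sum_(i < n) (n%:R^-1 * sigma ^+ 2).
  by rewrite sumr_const card_ord -[RHS]mulr_natl mulrA mulfV ?mul1r ?n_neq0.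
apply: ler_sum => i _; rewrite JmxE ler_wpM2l ?invr_ge0//.
exact: nvar_le.
Qed.

(* The noise enters [Y t] through [A]. The rows of the noise being uncorrelated,
   only the diagonal of [A - J] contributes to its correlation with [noise t],
   and that diagonal is at least [- 1 / n]. *)
Lemma denoised_sq_le t (A : 'M[R]_n) (U : L2 P n p) :
  (forall i j, 0 <= A i j) -> Jmx R n *m A = Jmx R n -> adapted t U ->
  YL t = lmulL2 A (U + NL t) ->
  Eip (PiL (YL t - NL t)) (PiL (YL t - NL t)) <=
  Eip (PiL (YL t)) (PiL (YL t)) + 2 * (n%:R * sigma ^+ 2).
Proof.
move=> A0 JA aU YE; set y := YL t; set N := NL t.
rewrite (@sqPi_sub _ _ (@Eip _ _ _ P n p) (@EipC _ _ _ P n p)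
  (@EipDl _ _ _ P n p) (@EipZl _ _ _ P n p) JL JLK EipJ).
have EyN : Eip (PiL y) N = \sum_i (A i i - n%:R^-1) * nvar t i.
  have -> : PiL y = lmulL2 (A - Jmx R n) U + lmulL2 (A - Jmx R n) N.
    rewrite /y YE -linearD /= lmulL2_comp JA; apply: L2P => w.
    by rewrite !(L2DE, L2NE) /= mulmxBl.
  rewrite EipDl Eip_noise0 ?add0r ?Eip_mul_noise; last exact: adapted_mul.
  by apply: eq_bigr => i _; rewrite mxE [(- Jmx _ _) _ _]mxE JmxE.
have ENN : Eip (PiL N) N = \sum_i (1 - n%:R^-1) * nvar t i.
  have -> : PiL N = lmulL2 (1%:M - Jmx R n) N.
    by apply: L2P => w; rewrite L2DE L2NE /= mulmxBl mul1mx.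
  rewrite Eip_mul_noise.
  by apply: eq_bigr => i _; rewrite mxE [(- Jmx _ _) _ _]mxE JmxE mxE eqxx.
rewrite EyN ENN.
rewrite -addrA lerD2l mulr_sumr -sumrN -big_split /=.
have -> : 2 * (n%:R * sigma ^+ 2) = \sum_(i < n) 2 * sigma ^+ 2.
  by rewrite sumr_const card_ord -[RHS]mulr_natl mulrCA.
(* The weight of each node variance is [-2 (A i i - 1/n) + (1 - 1/n) <= 1 + 1/n <= 2]. *)
apply: ler_sum => i _.
have n1 : n%:R^-1 <= 1 :> R by rewrite invf_le1 ?ltr0n// ler1n.
have := mulr_ge0 (A0 i i) (nvar_ge0 t i).
have := ler_wpM2r (nvar_ge0 t i) n1.
have := nvar_le t i; lra.
Qed.

(** * One round of the algorithm as an instance of the abstract estimate *)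

Section Round.
Variables (mu : R) (xstar : 'rV[R]_p).
Hypothesis mu_gt0 : 0 < mu.
Hypothesis f_sc : forall i, strongly_convex mu (fl i).
Hypothesis gap_ge0 : forall z, 0 <= gap fl xstar z.
Hypothesis W_ds : doubly_stochastic W.
Hypothesis rho_lt1 : rho W < 1.
Hypothesis d1_gt0 : (0 < d1)%N.
Hypothesis gamma_gt0 : 0 < gamma.

Notation WL := (lmulL2 (W ^+ d1)).
Notation V := (L2 P n p).

Lemma Eip_le c (A B C E : V) :
  (forall w, ip (A w) (B w) <= c * ip (C w) (E w)) -> Eip A B <= c * Eip C E.
Proof.
move=> H; rewrite -[Eip A B]mul1r; apply: le_Eip => w; rewrite mul1r; exact: H.
Qed.

Lemma adaptedD t (A B : V) : adapted t A -> adapted t B ->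
  adapted t (A + B : V).
Proof.
move=> aA aB i; exact: (closed_add (@mx_measurable_lin R _ (other i t) n p)
  (aA i) (aB i)).
Qed.

Lemma adaptedB t (A B : V) : adapted t A -> adapted t B ->
  adapted t (A - B : V).
Proof.
move=> aA aB i; exact: (closed_sub (@mx_measurable_lin R _ (other i t) n p)
  (aA i) (aB i)).
Qed.

Lemma adaptedL t (M : 'M[R]_n) (A : V) : adapted t A -> adapted t (lmulL2 M A).
Proof. exact: adapted_mul. Qed.

Lemma adapted_gradL t (A : V) : adapted t A -> adapted t (gradL A).
Proof. exact: adapted_grad. Qed.

Lemma stacked_gradE s w :
  stacked_grad F (fun i => xi i s w) (X s w) = gradL (XL s) w + NL s w.
Proof. by rewrite /= /noise addrC subrK. Qed.

Lemma subr_regroup (U : zmodType) (y a b c e : U) :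
  y + (a + b) - (c + e) = y - e + (a - c) + b.
Proof.
rewrite opprD (addrC (- c)) addrACA -[RHS]addrA; congr (_ + _).
by rewrite addrAC.
Qed.

(** For [j < d2] this is the iterate itself; [j = d2] is the point just before communication, which
    is not an iterate. *)
Definition Xr k j : V :=
  XL (d2 * k) - gamma *: \sum_(0 <= l < j) YL (d2 * k + l)%N.
Definition Qr k : V := YL (d2 * k) - NL (d2 * k).
Definition gr k l : V := gradL (XL (d2 * k + l)).

Lemma Xr_app k l w :
  Xr k l w = X (d2 * k)%N w - gamma *: \sum_(0 <= j < l) Y (d2 * k + j)%N w.
Proof.
transitivity (X (d2 * k)%N w
  - gamma *: (\sum_(0 <= j < l) YL (d2 * k + j)%N : V) w) => //.
by rewrite L2_sumE.
Qed.

Lemma Xr0 k : Xr k 0 = XL (d2 * k).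
Proof. by rewrite /Xr big_geq// scaler0 subr0. Qed.

Lemma XrE k l : (l < d2)%N -> XL (d2 * k + l) = Xr k l.
Proof.
case: l => [|l] ld; first by rewrite Xr0 addn0.
apply: L2P => w; rewrite Xr_app.
by rewrite /= (flexGT_Xlocal (XY w))//; lia.
Qed.

Lemma XL_comm k : XL (d2 * k.+1) = WL (Xr k d2).
Proof.
apply: L2P => w; transitivity (W ^+ d1 *m Xr k d2 w) => //.
by rewrite Xr_app; exact: (flexGT_Xcomm (XY w)).
Qed.

Lemma YLE k l : (l < d2)%N ->
  YL (d2 * k + l) = Qr k + (gr k l - gr k 0%N) + NL (d2 * k + l).
Proof.
case: l => [|l] ld.
  by rewrite subrr addr0 addn0 /Qr subrK.
apply: L2P => w; rewrite /gr addn0.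
transitivity (Y (d2 * k)%N w + (gradL (XL (d2 * k + l.+1)) w + NL (d2 * k +
  l.+1) w)
    - (gradL (XL (d2 * k)) w + NL (d2 * k) w)).
  by rewrite -!stacked_gradE; apply: (flexGT_Ylocal (XY w)); lia.
transitivity (Y (d2 * k)%N w - NL (d2 * k) w
  + (gradL (XL (d2 * k + l.+1)) w - gradL (XL (d2 * k)) w)
  + NL (d2 * k + l.+1) w) => //; exact: subr_regroup.
Qed.

Lemma YL_comm k :
  YL (d2 * k.+1) = WL (Qr k + (gradL (XL (d2 * k.+1)) - gr k 0%N) +
    NL (d2 * k.+1)).
Proof.
apply: L2P => w; rewrite /gr addn0.
transitivity (W ^+ d1 *m (Y (d2 * k)%N w
    + (gradL (XL (d2 * k.+1)) w + NL (d2 * k.+1) w)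
    - (gradL (XL (d2 * k)) w + NL (d2 * k) w))).
  by rewrite -!stacked_gradE; apply: (flexGT_Ycomm (XY w)).
transitivity (W ^+ d1 *m (Y (d2 * k)%N w - NL (d2 * k) w
  + (gradL (XL (d2 * k.+1)) w - gradL (XL (d2 * k)) w)
  + NL (d2 * k.+1) w)) => //; congr (_ *m _); exact: subr_regroup.
Qed.

Lemma Xr_expand k i : (i <= d2)%N -> Xr k i = Xr k 0%N - gamma *:
  (i%:R *: Qr k + \sum_(0 <= l < i) (gr k l - gr k 0%N)
   + \sum_(0 <= l < i) NL (d2 * k + l)).
Proof.
move=> id; rewrite Xr0 /Xr; congr (_ - _ *: _).
have -> : i%:R *: Qr k = \sum_(0 <= l < i) Qr k.
  by rewrite sumr_const_nat subn0 scaler_nat.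
rewrite -!big_split /= [LHS]big_nat [RHS]big_nat; apply: eq_bigr => l /= li.
by rewrite YLE//; exact: leq_trans id.
Qed.

(** The gradient tracking invariant: mixing preserves averages and the increments of [Y] telescope,
    so [Y] always has the average of the current stochastic gradients. Subtracting the noise leaves
    the exact ones. *)
Lemma J_tracker k : JL (Qr k) = JL (gr k 0%N).
Proof.
have JY w : Jmx R n *m Y (d2 * k)%N w =
    Jmx R n *m (gradL (XL (d2 * k)) w + NL (d2 * k) w).
  elim: k => [|k' IH].
    rewrite -stacked_gradE muln0; congr (_ *m _); exact: (flexGT_Y0 (XY w)).
  rewrite (flexGT_Ycomm (XY w)) mulmxA (ds_Jexp W_ds) !stacked_gradE mulmxBr
    mulmxDr IH.
  have cancel (a b : 'M[R]_(n, p)) : a + b - a = b by rewrite addrC addKr.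
  exact: cancel.
apply: L2P => w; rewrite /gr addn0.
transitivity (Jmx R n *m (Y (d2 * k)%N w - NL (d2 * k) w)) => //.
by rewrite mulmxBr JY mulmxDr addrK.
Qed.

Lemma adapted_XL t s : (s <= t)%N -> adapted t (XL s).
Proof. exact: adapted_X. Qed.

Lemma adapted_NL t s : (s < t)%N -> adapted t (NL s).
Proof. exact: adapted_noise. Qed.

Lemma adapted_gr t k l : (d2 * k + l <= t)%N -> adapted t (gr k l).
Proof. by move=> lt; apply: adapted_gradL; exact: adapted_XL. Qed.

Lemma adapted_Qr t k : (d2 * k < t)%N -> adapted t (Qr k).
Proof. by move=> kt; apply: adaptedB; [exact: adapted_Y | exact: adapted_NL].
  Qed.

Lemma ltn_round k : (d2 * k < d2 * k.+1)%N.
Proof. by rewrite ltn_pmul2l. Qed.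

(** The noise enters through [W ^+ d1] after a communication, but directly, with [A = 1], at time
    0. *)
Lemma tracker_start k : Eip (PiL (Qr k)) (PiL (Qr k)) <=
  Eip (PiL (YL (d2 * k))) (PiL (YL (d2 * k))) + 2 * (n%:R * sigma ^+ 2).
Proof.
case: k => [|k].
  apply: (@denoised_sq_le _ 1%:M (gradL (XL (d2 * 0)))).
  - by move=> i j; rewrite mxE ler0n.
  - by rewrite mulmx1.
  - by apply: adapted_gradL; exact: adapted_XL.
  rewrite lmulL2_1; apply: L2P => w.
  transitivity (stacked_grad F (fun i => xi i (d2 * 0)%N w) (X (d2 * 0)%N w)).
    by rewrite muln0; exact: (flexGT_Y0 (XY w)).
  exact: stacked_gradE.
apply: (@denoised_sq_le _ (W ^+ d1)
  (Qr k + (gradL (XL (d2 * k.+1)) - gr k 0%N))).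
- by move=> i j; exact: ds_exp_ge0.
- exact: ds_Jexp.
- have := ltn_round k => kt; apply: adaptedD; first exact: adapted_Qr.
  apply: adaptedB; first by apply: adapted_gradL; exact: adapted_XL.
  by apply: adapted_gr; rewrite addn0 ltnW.
exact: YL_comm.
Qed.

Section Gap.
Variable t : nat.

Definition mean_gap : R := (\int[P]_w gap fl xstar (avg (X t w)))%R.
Definition XsL : V := mkL2 (sqint_cst P (ones R n *m xstar)).

(** The gap is nonnegative and, by [gap_descent] at the averaged point, below an inner product of
    two square-integrable matrices. *)
Lemma gap_integrable :
  P.-integrable setT (fun w => (gap fl xstar (avg (X t w)))%:E).
Proof.
pose i0 := Ordinal n_gt0.
have mX : mx_measurable (JL (XL t)).
  by move=> i j; have [] := L2_sqint (JL (XL t)) i j.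
have mavg j : measurable_fun setT (fun w => avg (X t w) 0 j).
  apply: (eq_measurable_fun (fun w => (Jmx R n *m X t w) i0 j)).
    by move=> w _; rewrite -(row_J (X t w) i0) [RHS]mxE.
  exact: mX.
apply: (le_integrable measurableT _ _
  (integrable_ip (L2_sqint (JL (XL t) - XsL)) (L2_sqint (gradL (JL (XL t)))))).
  apply/measurable_EFinP; apply: measurable_sum => i;
    apply: measurable_funB => //.
  apply: (measurable_caratheodory mavg (h := fun z _ => fl i z)) => // w z.
  exact/(@differentiable_continuous _ _ _ _ (fl i : 'rV[R]_p -> R^o))/fl_diff.
move=> w _; rewrite /= lee_fin ger0_norm//; apply: le_trans (ler_norm _).
have := gap_descent (ltW mu_gt0) L_gt0 f_sc f_smooth (X t w)
  (Jmx R n *m X t w) xstar.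
by rewrite subrr ip0l mulr0 addr0.
Qed.

Lemma mean_gap_ge0 : 0 <= mean_gap.
Proof. by apply: Rintegral_ge0 => w _; exact: gap_ge0. Qed.

Lemma mean_gap_le c (A B C E : V) :
  (forall w, gap fl xstar (avg (X t w)) <= ip (A w) (B w) + c * ip (C w)
    (E w)) ->
  mean_gap <= Eip A B + c * Eip C E.
Proof.
move=> H; have i1 := integrable_ip (L2_sqint A) (L2_sqint B).
have i2 := integrable_ip (L2_sqint C) (L2_sqint E).
have i3 := integrableZl measurableT c i2.
rewrite /Eip -(RintegralZl c measurableT i2) -(RintegralD measurableT i1 i3).
apply: le_Rintegral => //; first exact: gap_integrable.
exact: (integrableD measurableT i1 i3).
Qed.

Lemma le_mean_gap a c (A B : V) :
  (forall w, a * ip (A w) (B w) <= c * gap fl xstar (avg (X t w))) ->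
  a * Eip A B <= c * mean_gap.
Proof.
move=> H; have i1 := integrable_ip (L2_sqint A) (L2_sqint B).
rewrite /Eip -(RintegralZl a measurableT i1) -(RintegralZl c measurableT
  gap_integrable).
apply: le_Rintegral => //; first exact: (integrableZl measurableT a i1).
exact: (integrableZl measurableT c gap_integrable).
Qed.

End Gap.

Notation r := (rho W ^+ d1).
Notation h := (gamma * d2%:R * L).

(** This is [n] times the expected Lyapunov value: stacking a mean error multiplies its square by
    [n], and [c1], [c2] both carry a factor [1 / n]. *)
Definition lyap t : R := Eip (JL (XL t) - XsL) (JL (XL t) - XsL)
  + 192 * h / (1 - r) * Eip (PiL (XL t)) (PiL (XL t))
  + 96 * 97 * (gamma * d2%:R) ^+ 2 * h / (1 - r) ^+ 3
    * Eip (PiL (YL t)) (PiL (YL t)).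

Lemma gradL_lip (A B : V) : Eip (gradL A - gradL B) (gradL A - gradL B) <=
  L ^+ 2 * Eip (A - B) (A - B).
Proof. by apply: Eip_le => w; exact: grad_mx_lip. Qed.

Lemma PiL_app (A : V) w : (PiL A) w = (1%:M - Jmx R n) *m A w.
Proof. by rewrite mulmxBl mul1mx. Qed.

Lemma round_step k m : 10 * h <= 1 -> (153 * h) ^+ 2 * r <= (1 - r) ^+ 4 ->
  m <= mu * (gamma * d2%:R) / 4 -> m <= (1 - r) / 8 ->
  lyap (d2 * k.+1) <= (1 - m) * lyap (d2 * k)
  + gamma ^+ 2 * d2%:R * sigma ^+ 2 + (gamma * d2%:R) ^+ 2 * h / (1 - r) ^+ 3
    * (36 * (1 - r) ^+ 3 + 36 * 96 * (1 - r) * r + 6 * 96 * 97 * r)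
    * (n%:R * sigma ^+ 2).
Proof.
move=> step step_r m1 m2.
have r0 : 0 <= r by rewrite exprn_ge0 ?rho_ge0.
have r1 : r < 1 by rewrite exprn_ilt1 ?rho_ge0 -?lt0n.
have g0 := ltW gamma_gt0; have L0 := ltW L_gt0; have rle1 := ltW rho_lt1.
have S0 : 0 <= n%:R * sigma ^+ 2 by rewrite mulr_ge0 ?sqr_ge0.
have n1 : 1 <= n%:R :> R by rewrite ler1n.
pose N l := NL (d2 * k + l).
have aX s : (d2 * k <= s)%N -> adapted s (XL (d2 * k)) by exact: adapted_XL.
have N_orth i j : (i < j < d2)%N -> Eip (N i) (N j) = 0.
  move=> /andP[ij _]; apply: Eip_noise0; apply: adapted_NL.
  by rewrite ltn_add2l.
have JN_orth i j : (i < j < d2)%N -> Eip (JL (N i)) (JL (N j)) = 0.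
  move=> /andP[ij _]; rewrite -EipJ JLK; apply: Eip_noise0.
  by apply: adaptedL; apply: adapted_NL; rewrite ltn_add2l.
have g_lip l : (l < d2)%N -> Eip (gr k l - gr k 0%N) (gr k l - gr k 0%N) <=
    L ^+ 2 * Eip (Xr k l - Xr k 0%N) (Xr k l - Xr k 0%N).
  by move=> ld; rewrite -XrE// -XrE//; exact: gradL_lip.
have gb_lip l : (l < d2)%N ->
    Eip (gr k l - gradL (JL (Xr k 0))) (gr k l - gradL (JL (Xr k 0))) <=
    L ^+ 2 * Eip (Xr k l - JL (Xr k 0%N)) (Xr k l - JL (Xr k 0%N)).
  by move=> ld; rewrite -(XrE k ld); exact: gradL_lip.
have JXs : JL XsL = XsL by apply: L2P => w; exact: J_ones.
have avgE w : avg (Xr k 0 w) = avg (X (d2 * k)%N w) by rewrite Xr0.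
have gb_sq : Eip (JL (gradL (JL (Xr k 0)))) (JL (gradL (JL (Xr k 0)))) <=
    2 * L * mean_gap (d2 * k).
  rewrite -[leLHS]mul1r; apply: le_mean_gap => w; rewrite mul1r Xr0.
  exact: gap_grad.
have descent l : (l < d2)%N -> mean_gap (d2 * k)
    - L / 2 * Eip (Xr k l - JL (Xr k 0)) (Xr k l - JL (Xr k 0)) <=
    Eip (JL (Xr k 0) - XsL) (gr k l).
  move=> ld; rewrite lerBlDr; apply: mean_gap_le => w; rewrite -(XrE k ld) Xr0.
  exact: (gap_descent (ltW mu_gt0) L_gt0 f_sc f_smooth).
have e_sc : mu / 4 * Eip (JL (Xr k 0) - XsL) (JL (Xr k 0) - XsL) <=
    mean_gap (d2 * k).
  rewrite -[leRHS]mul1r; apply: le_mean_gap => w; rewrite mul1r Xr0.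
  have -> : (JL (XL (d2 * k)) - XsL) w =
      ones R n *m (avg (X (d2 * k)%N w) - xstar).
    by rewrite mulmxBr ones_avg.
  by rewrite ip_ones; exact: gap_sc.
have Np_orth : Eip (PiL (Qr k + (gradL (XL (d2 * k.+1)) - gr k 0%N)))
    (NL (d2 * k.+1)) = 0.
  have kt := ltn_round k; apply: Eip_noise0.
  have aU : adapted (d2 * k.+1) (Qr k + (gradL (XL (d2 * k.+1)) - gr k 0%N)
    : V).
    apply: adaptedD; first exact: adapted_Qr.
    apply: adaptedB; first by apply: adapted_gradL; exact: adapted_XL.
    by apply: adapted_gr; rewrite addn0 ltnW.
  by apply: adaptedB => //; exact: adaptedL.
have D0_orth l : (l < d2)%N -> Eip (JL (Xr k 0) - XsL) (N l) = 0.
  move=> ld; apply: Eip_noise0; rewrite Xr0; apply: adaptedB.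
    by apply: adaptedL; apply: adapted_XL; exact: leq_addr.
  by move=> i; exact: mx_measurable_cst.
have g0_orth l : (l < d2)%N -> Eip (JL (gr k 0%N)) (N l) = 0.
  move=> ld; apply: Eip_noise0; apply: adaptedL; apply: adapted_gr.
  by rewrite addn0 leq_addr.
have gp_lip : Eip (gradL (XL (d2 * k.+1)) - gr k 0%N)
    (gradL (XL (d2 * k.+1)) - gr k 0%N) <=
    L ^+ 2 * Eip (WL (Xr k d2) - Xr k 0%N) (WL (Xr k d2) - Xr k 0%N).
  by rewrite -XL_comm -(XrE k d2_gt0); exact: gradL_lip.
have JW (A : V) : JL (WL A) = JL A by rewrite lmulL2_comp ds_Jexp.
have W_mix (A : V) : Eip (PiL (WL A)) (PiL (WL A)) <= r * Eip (PiL A) (PiL A).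
  by apply: Eip_le => w; rewrite !PiL_app; exact: ds_mix_le.
have W_nonexp (A : V) : Eip (WL A) (WL A) <= Eip A A.
  by rewrite -[leRHS]mul1r; apply: Eip_le => w; rewrite mul1r; exact: ds_nonexp.
have W_drift (A : V) : Eip (WL A - A) (WL A - A) <= 4 * Eip (PiL A) (PiL A).
  by apply: Eip_le => w; rewrite !PiL_app; exact: ds_drift_le.
have s_le : sigma ^+ 2 <= n%:R * sigma ^+ 2 by rewrite ler_peMl ?sqr_ge0.
have r01 : 0 <= r < 1 by rewrite r0 r1.
rewrite /lyap XL_comm YL_comm -[XL (d2 * k)]Xr0.
exact: (lyapunov_step (@EipC _ _ _ P n p) (@EipDl _ _ _ P n p)
  (@EipZl _ _ _ P n p) (@Eip_ge0 _ _ _ P n p) JLK EipJ d2_gt0 g0 L0 S0 step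
  (@Xr_expand k) g_lip (fun l _ => noise_sq_le (d2 * k + l)) N_orth r01 JW W_mix
  W_nonexp W_drift gp_lip (noise_sq_le (d2 * k.+1)) Np_orth (tracker_start k)
  (J_tracker k) gb_lip gb_sq JXs descent (fun l _ => noise_J_sq_le (d2 * k + l))
  JN_orth D0_orth g0_orth L_gt0 gamma_gt0 (mean_gap_ge0 (d2 * k)) s_le e_sc
  step_r m1 m2).
Qed.

Lemma expectation_lyapunov t a b (V0 : Omega -> R) :
  (forall w, V0 w = lyapunov a b xstar (X t w) (Y t w)) ->
  ('E_P[V0] = (n%:R^-1 * Eip (JL (XL t) - XsL) (JL (XL t) - XsL)
    + a * Eip (PiL (XL t)) (PiL (XL t)) + b * Eip (PiL (YL t))
      (PiL (YL t)))%R%:E)%E.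
Proof.
move=> VE; rewrite unlock.
set u := JL (XL t) - XsL; set v := PiL (XL t); set z := PiL (YL t).
have iu := integrableZl measurableT n%:R^-1 (integrable_ip (L2_sqint u)
  (L2_sqint u)).
have iv := integrableZl measurableT a (integrable_ip (L2_sqint v) (L2_sqint v)).
have iz := integrableZl measurableT b (integrable_ip (L2_sqint z) (L2_sqint z)).
have iuv := integrableD measurableT iu iv.
have iuvz := integrableD measurableT iuv iz.
transitivity (\int[P]_w (n%:R^-1 * ip (u w) (u w) + a * ip (v w) (v w)
    + b * ip (z w) (z w))%:E)%E.
  apply: eq_integral => w _; congr EFin; rewrite VE /lyapunov !fnorm_sq.
  have -> : u w = ones R n *m (avg (X t w) - xstar).
    by rewrite mulmxBr ones_avg.
  by rewrite ip_ones mulrA mulVf ?n_neq0// mul1r !ones_avg.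
rewrite -[LHS]fineK; last exact: (integrable_fin_num measurableT iuvz).
congr EFin; rewrite /Eip.
rewrite -(RintegralZl n%:R^-1 measurableT (integrable_ip (L2_sqint u)
  (L2_sqint u))).
rewrite -(RintegralZl a measurableT (integrable_ip (L2_sqint v) (L2_sqint v))).
rewrite -(RintegralZl b measurableT (integrable_ip (L2_sqint z) (L2_sqint z))).
by rewrite -(RintegralD measurableT iu iv) -(RintegralD measurableT iuv iz).
Qed.

End Round.

End Noise.

(** * Step size and weights *)

(** A large literal is an unevaluated decimal conversion; unfolding it into products by ten avoids
    building a unary number. *)
Lemma nat_9312 : (9312 = 96 * 97)%N.
Proof.
cbv [Nat.of_num_uint Nat.of_uint Nat.of_uint_acc].
rewrite !PeanoNat.Nat.tail_mul_spec; lia.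
Qed.

Lemma nat_55872 : (55872 = 6 * 96 * 97)%N.
Proof.
cbv [Nat.of_num_uint Nat.of_uint Nat.of_uint_acc].
rewrite !PeanoNat.Nat.tail_mul_spec; lia.
Qed.

Section ParameterConversions.
Variables (R : realType) (n d1 d2 : nat) (rhoW gamma L sigma : R).
Notation r := (rhoW ^+ d1).
Notation h := (gamma * d2%:R * L).
Hypotheses (n_gt0 : (0 < n)%N) (d2_gt0 : (0 < d2)%N).
Hypotheses (L_gt0 : 0 < L) (gamma_gt0 : 0 < gamma) (rho_ge0 : 0 <= rhoW)
  (r_lt1 : r < 1).

Let q_neq0 : 1 - r != 0. Proof. by rewrite subr_eq0 eq_sym lt_eqF. Qed.

Lemma c1E : c1 n d1 d2 rhoW gamma L = n%:R^-1 * (192 * h / (1 - r)).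
Proof. by rewrite /c1; field; rewrite q_neq0 n_neq0. Qed.

Lemma c2E : c2 n d1 d2 rhoW gamma L =
  n%:R^-1 * (96 * 97 * (gamma * d2%:R) ^+ 2 * h / (1 - r) ^+ 3).
Proof. by rewrite /c2 nat_9312 natrM; field; rewrite q_neq0 n_neq0. Qed.

Lemma MsigmaE : Msigma d1 rhoW sigma =
  (36 * (1 - r) ^+ 3 + 36 * 96 * (1 - r) * r + 6 * 96 * 97 * r) * sigma ^+ 2.
Proof.
have -> : 36 * 96 = 3456 :> R by rewrite -natrM.
by rewrite /Msigma nat_55872 !natrM -!mulrDl.
Qed.

Lemma stepsize_boundP : (gamma%:E <= stepsize_bound d1 d2 rhoW L)%E ->
  10 * h <= 1 /\ (153 * h) ^+ 2 * r <= (1 - r) ^+ 4.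
Proof.
have dp : 0 < d2%:R :> R by rewrite ltr0n.
have r0 : 0 <= r by rewrite exprn_ge0.
have ediv (a x : R) : 0 < x -> (gamma%:E <= a%:E / x%:E)%E -> gamma * x <= a.
  by move=> x0; rewrite inver gt_eqF// -EFinM lee_fin ler_pdivlMr.
have p10 : 0 < 10 * d2%:R * L by apply: mulr_gt0 => //; rewrite mulr_gt0 ?ltr0n.
rewrite /stepsize_bound !le_min => /and3P[/(ediv _ _ p10) s1 _ s3]; split.
  by have -> : 10 * h = gamma * (10 * d2%:R * L) by ring.
(* When [r = 0] the third quotient is [+oo] and carries no information, but the claim reduces to
   [0 <= 1]. *)
have [r00|rn0] := eqVneq r 0.
  by rewrite r00 mulr0 subr0 expr1n.
have sp : 0 < Num.sqrt r by rewrite sqrtr_gt0 lt_def rn0.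
have p153 : 0 < 153 * d2%:R * L * Num.sqrt r.
  by rewrite (mulr_gt0 _ sp)// (mulr_gt0 _ L_gt0)// mulr_gt0 ?ltr0n.
move/(ediv _ _ p153) : s3 => {}s3.
have -> : (153 * h) ^+ 2 * r = (gamma * (153 * d2%:R * L * Num.sqrt r)) ^+ 2.
  by rewrite -[X in _ * X](sqr_sqrtr r0); ring.
rewrite (_ : (1 - r) ^+ 4 = ((1 - r) ^+ 2) ^+ 2); last by rewrite -exprM.
rewrite ler_pXn2r// nnegrE; last exact: sqr_ge0.
by apply: ltW; exact: mulr_gt0.
Qed.

End ParameterConversions.

Theorem theorem1 (R : realType) (n p : nat) (n_gt0 : (0 < n)%N)
    (* probability space, samples and sample costs *)
    (dO : measure_display) (Omega : measurableType dO) (P : probability Omega R)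
    (d : 'I_n -> measure_display) (Xi : forall i, measurableType (d i))
    (D : forall i, probability (Xi i) R)
    (xi : forall i : 'I_n, nat -> {RV P >-> Xi i})
    (F : forall i, 'rV[R]_p -> Xi i -> R)
    (mu L sigma : R) (mu_gt0 : 0 < mu) (L_gt0 : 0 < L) (sigma_ge0 : 0 <= sigma)
    (F_int : forall i x, (D i).-integrable setT (EFin \o F i x))
    (F_diff : forall i s, differentiable_everywhere (fun x => F i x s))
    (f_sc : forall i, strongly_convex mu (local_cost F D i))
    (f_smooth : forall i, smooth L (local_cost F D i))
    (F_unbiased : unbiased F D)
    (F_variance : variance_le F D sigma)
    (xi_law : forall i t (A : set (Xi i)), measurable A ->
      distribution P (xi i t) A = D i A)
    (xi_indep : mutually_independent
      (fun it : 'I_n * nat => xi it.1 it.2))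
    (xstar : 'rV[R]_p) (xstar_min : forall x, cost F D xstar <= cost F D x)
    (W : 'M[R]_n) (W_ds : doubly_stochastic W) (rho_lt1 : rho W < 1)
    (d1 d2 : nat) (d1_ge1 : (1 <= d1)%N) (d2_ge1 : (1 <= d2)%N)
    (gamma : R) (gamma_gt0 : 0 < gamma)
    (x0 : 'M[R]_(n, p)) (X Y : nat -> Omega -> 'M[R]_(n, p))
    (XY_flexGT : forall w, flexGT W d1 d2 gamma
      (fun t => stacked_grad F (fun i => xi i t w)) x0 (X ^~ w) (Y ^~ w))
    (gamma_le : (gamma%:E <= stepsize_bound d1 d2 (rho W) L)%E)
    (V : nat -> Omega -> R)
    (V_def : forall t w, V t w =
      lyapunov (c1 n d1 d2 (rho W) gamma L) (c2 n d1 d2 (rho W) gamma L)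
        xstar (X t w) (Y t w)) :
  forall k : nat,
    ('E_P[V (d2 * k.+1)%N] <=
      (1 - Num.min (mu * d2%:R * gamma / 4) ((1 - rho W ^+ d1) / 8))%:E
        * 'E_P[V (d2 * k)%N]
      + (d2%:R * gamma ^+ 2 * sigma ^+ 2 / n%:R
         + d2%:R ^+ 3 * gamma ^+ 3 * L / (1 - rho W ^+ d1) ^+ 3
           * Msigma d1 (rho W) sigma)%:E)%E.
Proof.
move=> k; have gap_ge0 z : 0 <= gap (local_cost F D) xstar z.
  rewrite /gap sumrB subr_ge0; have := xstar_min z; rewrite /cost.
  by rewrite ler_pM2l// invr_gt0 ltr0n.
have r_lt1 : rho W ^+ d1 < 1 by rewrite exprn_ilt1 ?rho_ge0 -?lt0n.
have [step step_r] := stepsize_boundP d2_ge1 L_gt0 gamma_gt0 (rho_ge0 W)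
  gamma_le.
have n0 : 0 < n%:R :> R by rewrite ltr0n.
pose r := rho W ^+ d1; pose m := Num.min (mu * d2%:R * gamma / 4) ((1 - r) / 8).
have m1 : m <= mu * (gamma * d2%:R) / 4.
  by rewrite [gamma * _]mulrC mulrA ge_min lexx.
have m2 : m <= (1 - r) / 8 by rewrite ge_min lexx orbT.
have := round_step L_gt0 sigma_ge0 F_int F_diff f_smooth F_unbiased F_variance
  xi_law xi_indep d2_ge1 XY_flexGT n_gt0 mu_gt0 f_sc gap_ge0 W_ds rho_lt1 d1_ge1
  gamma_gt0 k step step_r m1 m2.
have EV t : ('E_P[V t])%E = (n%:R^-1 * lyap L_gt0 F_int F_diff f_smooth
    F_variance xi_law xi_indep d2_ge1 XY_flexGT xstar t)%:E.
  rewrite (expectation_lyapunov L_gt0 F_int F_diff f_smooth F_variance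
    xi_law xi_indep d2_ge1 XY_flexGT n_gt0 (V_def t)) c1E// c2E// /lyap.
  have dist (i a b c x y : R) :
    i * a + i * x * b + i * y * c = i * (a + x * b + y * c) by ring.
  by rewrite dist.
rewrite !EV -EFinM -EFinD lee_fin MsigmaE -/r -/m.
set v1 := lyap _ _ _ _ _ _ _ _ _ _ (d2 * k.+1).
set v0 := lyap _ _ _ _ _ _ _ _ _ _ (d2 * k).
move=> H; have n0V : 0 <= n%:R^-1 :> R by rewrite invr_ge0 ltW.
(* Dividing by [n] turns the round estimate into the claim with equality: [n sigma^2] loses its
   factor and the noise of the mean gains [1 / n]. *)
apply: le_trans (ler_wpM2l n0V H) _; rewrite le_eqVlt;
  apply/orP; left; apply/eqP.
have q0 : 1 - r != 0 by rewrite subr_eq0 gt_eqF.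
by field; rewrite q0 gt_eqF.
Qed.
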